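(* Let $W$ be any binary memoryless symmetric (BMS) channel with capacity $C \in (0,1)$. For every sequence of Reed--Muller codes $\mathrm{RM}(r_n,m_n)$ with strictly increasing blocklength $2^{m_n}$ and rate $R(r_n,m_n)$ converging to some $R \in [0,C)$, the bit-error probability under bit-MAP decoding converges to zero, i.e. $\max_{i \in [2^{m_n}]} \Pr\big(X_i \neq \phi_i(\mathbf{Y})\big) \to 0$ as $n\to\infty$.
   Context: A BMS channel has input alphabet $\{\pm 1\}$, output alphabet the extended reals $\overline{\mathbb{R}}$, and transition density satisfying $w(y\mid +1)=w(-y\mid -1)$; it is used memorylessly (independent identically distributed uses given the inputs). Its capacity is $I(X;Y)$ for uniform input $X$. For integers $0\le r\le m$, $\mathrm{RM}(r,m)\subseteq\mathbb{F}_2^{2^m}$ is the set of vectors $(p(\tau^{-1}(0)),\dots,p(\tau^{-1}(2^m-1)))$ where $p$ ranges over $\mathbb{F}_2$-multilinear polynomials in $m$ indeterminates of total degree at most $r$ and $\tau(\mathbf{v})=\sum_{j=0}^{m-1} v_j 2^j$ for $\mathbf{v}\in\mathbb{F}_2^m$. Its rate is $R(r,m)=2^{-m}\sum_{i=0}^r\binom{m}{i}$. $[N]=\{0,\dots,N-1\}$. The transmitted vector $\mathbf{X}=(-1)^{\mathbf{u}}$ (BPSK) where $\mathbf{u}$ is a uniformly random codeword, $\mathbf{Y}$ is the channel output, and $\phi_i(\mathbf{y})=\arg\max_{x\in\{\pm1\}}\Pr(X_i=x\mid \mathbf{Y}=\mathbf{y})$ is the bit-MAP decision for code bit $i$. 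*)

(* Defs.v *)
From HB Require Import structures.
From mathcomp Require Import all_boot all_order all_algebra.
From mathcomp Require Import all_classical all_reals all_analysis measurable_realfun.

Set Implicit Arguments.
Unset Strict Implicit.
Unset Printing Implicit Defensive.

Import Order.TTheory GRing.Theory Num.Theory numFieldNormedType.Exports.
Local Open Scope classical_set_scope.
Local Open Scope ring_scope.

Section BMS.
Variable R : realType.

(* A BMS channel is given by a reference measure [mu] on the extended reals
   (the output alphabet) and the density [w y = w(y | +1)] w.r.t. [mu];
   the symmetry condition w(y | +1) = w(-y | -1) DEFINES w(. | -1).
   [mu] is required sigma-finite and invariant under y |-> -y (so that the
   density condition indeed says the law of Y given X = -1 is the reflection
   of the law of Y given X = +1). *)

Definition chan_dens (w : \bar R -> R) (x : R) (y : \bar R) : R :=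
  if x == 1 then w y else w (- y)%E.

Definition is_BMS (mu : {measure set (\bar R) -> \bar R}) (w : \bar R -> R) : Prop :=
  [/\ sigma_finite setT mu,
      (forall A : set (\bar R), measurable A ->
         mu ((fun y : \bar R => - y)%E @^-1` A) = mu A),
      (forall y, 0 <= w y),
      measurable_fun setT w &
      (\int[mu]_y (w y)%:E = 1)%E].

Definition plog2 (a b : R) : R := if a == 0 then 0 else a * (ln (a / b) / ln 2).

Definition out_dens (w : \bar R -> R) (y : \bar R) : R :=
  (chan_dens w 1 y + chan_dens w (-1) y) / 2.

(* capacity = I(X;Y) for uniform X
   = int sum_{x = +-1} 1/2 w(y|x) log2 (w(y|x) / p(y)) dmu(y) *)
Definition capacity (mu : {measure set (\bar R) -> \bar R}) (w : \bar R -> R)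
  : \bar R :=
  (\int[mu]_y ((plog2 (chan_dens w 1 y) (out_dens w y)
              + plog2 (chan_dens w (-1) y) (out_dens w y)) / 2)%:E)%E.

(* j-th coordinate of tau^{-1}(k): the j-th binary digit of k *)
Definition bit (k j : nat) : bool := odd (k %/ 2 ^ j).

(* RM(r,m): evaluations of F_2-multilinear polynomials of degree <= r,
   p = sum_{S, |S| <= r} c_S prod_{j in S} v_j  (F_2 = bool, + = addb) *)
Definition RM (r m : nat) : {set {ffun 'I_(2 ^ m) -> bool}} :=
  [set u : {ffun 'I_(2 ^ m) -> bool} | [exists c : {ffun {set 'I_m} -> bool},
     [forall S : {set 'I_m}, (r < #|S|)%N ==> ~~ c S] &&
     [forall k : 'I_(2 ^ m),
        u k == \big[addb/false]_(S : {set 'I_m})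
                  (c S && [forall j in S, bit k j])]]].

Definition rate (r m : nat) : R :=
  (\sum_(i < r.+1) 'C(m, i))%:R / (2 ^ m)%:R.

Definition bpsk (b : bool) : R := (-1) ^+ b.

(* iterated integral over (\bar R)^n w.r.t. mu^{(x) n}; outputs are lists of
   length n (for nonnegative measurable integrands this is, by Tonelli, the
   integral against the n-fold product measure) *)
Fixpoint iint (mu : {measure set (\bar R) -> \bar R}) (n : nat)
  (F : seq (\bar R) -> \bar R) : \bar R :=
  match n with
  | 0 => F [::]
  | n'.+1 => (\int[mu]_y iint mu n' (fun s => F (y :: s)))%E
  end.

Definition lik (w : \bar R -> R) (N : nat) (u : {ffun 'I_N -> bool})
  (y : seq (\bar R)) : R :=
  \prod_(j < N) chan_dens w (bpsk (u j)) (nth 0%E y j).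

Definition posterior (w : \bar R -> R) (N : nat) (C : {set {ffun 'I_N -> bool}})
  (i : 'I_N) (x : R) (y : seq (\bar R)) : R :=
  (\sum_(u in C | bpsk (u i) == x) #|C|%:R^-1 * lik w u y)
  / (\sum_(u in C) #|C|%:R^-1 * lik w u y).

Definition bitMAP (w : \bar R -> R) (N : nat) (C : {set {ffun 'I_N -> bool}})
  (i : 'I_N) (y : seq (\bar R)) : R :=
  if posterior w C i (-1) y <= posterior w C i 1 y then 1 else -1.

Definition bit_err (mu : {measure set (\bar R) -> \bar R}) (w : \bar R -> R)
  (N : nat) (C : {set {ffun 'I_N -> bool}}) (i : 'I_N) : \bar R :=
  (\sum_(u in C) (#|C|%:R^-1)%:E *
     iint mu N (fun y => ((bpsk (u i) != bitMAP w C i y)%:R * lik w u y)%:E))%E.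

End BMS.

(* Main.v *)
Require Import Defs.
From HB Require Import structures.
From mathcomp Require Import all_boot all_order all_algebra.
From mathcomp Require Import all_classical all_reals all_analysis measurable_realfun.
From mathcomp Require Import ring lra zify.
Import Order.TTheory GRing.Theory Num.Theory numFieldNormedType.Exports.

(** Quantize the channel output into a finite alphabet, softened by a little
    uniform noise so that all cells have positive probability, losing
    arbitrarily little capacity; MAP decoding of the original output is at least
    as good as any rule using the quantized one. For a linear code on a symmetric
    channel everything can be computed under the all-zero codeword, i.e. under a
    product measure [Q], where the extrinsic posterior mean [f] of a code bit
    satisfies [E f = E f^2 =: mu] (Nishimori), hence [Var f = mu (1 - mu)].

    Erase every output independently with probability [1 - t]. The normalized
    mutual information [Gam] between codeword and output has derivative [Delta],
    the information of one more use of the channel given the other outputs. The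
    Plotkin extension RM(r, m+1) of RM(r, m) contains the copies
    [{(v, chi v)}] of the index set of RM(r, m), one for every linear form [chi].
    The rates of the two codes differ by only [C(m, r) / 2^(m+1)], so for some
    [t] close to 1 the two [Delta]'s are close; by a strong form of Gibbs'
    inequality ([phi_sep]) the estimates [f] built from different copies are then
    close in [L^2(Q)]. Two copies share only the outputs with [chi v = 0], that is
    half of them, and an Efron-Stein argument averaged over [chi] shows
    [Var f -> 0]. Hence [mu] is near 0 or 1; the former would make [Delta] almost
    equal to the capacity on [0, t], so that the rate could not stay below capacity. *)

Set Implicit Arguments.
Unset Strict Implicit.
Unset Printing Implicit Defensive.

Local Open Scope ring_scope.

(** * Product measures on finite alphabets *)

Section ProductExpectation.
Variables (R : realType) (T : finType).

Definition upd (I : finType) (y : {ffun I -> T}) (i : I) (z : T) : {ffun I -> T} :=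
  [ffun j => if j == i then z else y j].

Definition Ex (I : finType) (q : I -> T -> R) (F : {ffun I -> T} -> R) : R :=
  \sum_(y : {ffun I -> T}) (\prod_i q i (y i)) * F y.

Definition set_law (I : finType) (q : I -> T -> R) (i : I) (p : T -> R) :=
  fun j => if j == i then p else q j.

Definition prob (p : T -> R) := (forall z, 0 <= p z) /\ \sum_z p z = 1.

Section OneIndex.
Variable I : finType.
Implicit Types (q : I -> T -> R) (F G : {ffun I -> T} -> R) (y : {ffun I -> T}).

Lemma eq_Ex q F G : F =1 G -> Ex q F = Ex q G.
Proof. by move=> FG; apply: eq_bigr => y _; rewrite FG. Qed.

Lemma eq_Ex_law q q' F : q =2 q' -> Ex q F = Ex q' F.
Proof.
by move=> qq; apply: eq_bigr => y _; congr (_ * _); apply: eq_bigr => i _.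
Qed.

Lemma ExD q F G : Ex q (fun y => F y + G y) = Ex q F + Ex q G.
Proof. by rewrite -big_split /=; apply: eq_bigr => y _; rewrite mulrDr. Qed.

Lemma ExN q F : Ex q (fun y => - F y) = - Ex q F.
Proof. by rewrite -sumrN; apply: eq_bigr => y _; rewrite mulrN. Qed.

Lemma ExB q F G : Ex q (fun y => F y - G y) = Ex q F - Ex q G.
Proof. by rewrite ExD ExN. Qed.

Lemma ExZ q F c : Ex q (fun y => c * F y) = c * Ex q F.
Proof. by rewrite mulr_sumr; apply: eq_bigr => y _; rewrite mulrCA. Qed.

Lemma Ex_sum (A : Type) (r : seq A) (P : pred A) q (F : A -> {ffun I -> T} -> R) :
  Ex q (fun y => \sum_(a <- r | P a) F a y) = \sum_(a <- r | P a) Ex q (F a).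
Proof.
by rewrite exchange_big /=; apply: eq_bigr => y _; rewrite mulr_sumr.
Qed.

Lemma Ex_cst q c : (forall i, \sum_z q i z = 1) -> Ex q (fun=> c) = c.
Proof.
move=> q1; rewrite /Ex -mulr_suml -(bigA_distr_bigA (fun i z => q i z)) big1 ?mul1r//.
Qed.

Lemma ler_Ex q F G : (forall i, prob (q i)) -> (forall y, F y <= G y) ->
  Ex q F <= Ex q G.
Proof.
move=> hq FG; apply: ler_sum => y _; apply: ler_wpM2l (FG y).
by apply: prodr_ge0 => i _; case: (hq i).
Qed.

Lemma Ex_ge0 q F : (forall i, prob (q i)) -> (forall y, 0 <= F y) -> 0 <= Ex q F.
Proof.
move=> hq F0; apply: sumr_ge0 => y _; apply: mulr_ge0 (F0 y).
by apply: prodr_ge0 => i _; case: (hq i).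
Qed.

Lemma upd_upd y i z z' : upd (upd y i z) i z' = upd y i z'.
Proof. by apply/ffunP => j; rewrite !ffunE; case: eqP. Qed.

Lemma upd_same y i : upd y i (y i) = y.
Proof. by apply/ffunP => j; rewrite ffunE; case: eqP => // ->. Qed.

Lemma upd_eq y i z : upd y i z i = z.
Proof. by rewrite ffunE eqxx. Qed.

(** Exchanging the drawn symbol [y i] with the fresh symbol [z] is an involution of the pairs
    [(y, z)]; it carries one double sum onto the other. *)
Lemma Ex_resample q i p F : \sum_z q i z = 1 ->
  Ex (set_law q i p) F = Ex q (fun y => \sum_z p z * F (upd y i z)).
Proof.
move=> qi1; rewrite /Ex.
under [RHS]eq_bigr do rewrite mulr_sumr.
rewrite pair_big /=.
pose h (x : {ffun I -> T} * T) := (upd x.1 i x.2, x.1 i).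
have hK : involutive h.
  by case=> y z; rewrite /h /= upd_upd upd_eq upd_same.
rewrite (reindex_inj (inv_inj hK)) /=.
rewrite -(pair_big xpredT xpredT
  (fun y z => (\prod_j q j (upd y i z j)) * (p (y i) * F (upd (upd y i z) i (y i))))) /=.
apply: eq_bigr => y _.
rewrite (bigD1 i) //= /set_law eqxx.
under [RHS]eq_bigr => z _.
  rewrite upd_upd upd_same (bigD1 i) //= upd_eq.
  rewrite (eq_bigr (fun j => q j (y j))); last first.
    by move=> j /negPf ji; rewrite ffunE ji.
  rewrite -mulrA.
  over.
rewrite -mulr_suml qi1 mul1r.
rewrite mulrCA mulrA; congr (_ * _ * _).
by apply: eq_bigr => j /negPf ->.
Qed.

Lemma Ex_resample_id q i F : \sum_z q i z = 1 ->
  Ex q F = Ex q (fun y => \sum_z q i z * F (upd y i z)).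
Proof.
move=> qi; rewrite -Ex_resample //; apply: eq_Ex_law => j z.
by rewrite /set_law; case: eqP => // ->.
Qed.

Lemma Ex_law_irrel q i p F : \sum_z q i z = 1 -> \sum_z p z = 1 ->
  (forall y z, F (upd y i z) = F y) -> Ex (set_law q i p) F = Ex q F.
Proof.
move=> qi pi hF; rewrite Ex_resample //; apply: eq_Ex => y.
by under eq_bigr do rewrite hF; rewrite -mulr_suml pi mul1r.
Qed.

Lemma Ex_eq0 q i F : \sum_z q i z = 1 ->
  (forall y, \sum_z q i z * F (upd y i z) = 0) -> Ex q F = 0.
Proof.
move=> qi hF; rewrite (Ex_resample_id _ qi); apply: big1 => y _.
by rewrite hF mulr0.
Qed.

End OneIndex.

Definition comp_ffun (I J : finType) (y : {ffun I -> T}) (h : J -> I) : {ffun J -> T} :=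
  [ffun j => y (h j)].

Lemma Ex_reindex (I : finType) (h : I -> I) q (F : {ffun I -> T} -> R) :
  injective h -> Ex q (fun y => F (comp_ffun y h)) = Ex (fun i => q (h i)) F.
Proof.
move=> hI; rewrite /Ex.
have cI : injective (fun y : {ffun I -> T} => comp_ffun y h).
  move=> y y' /ffunP yy; apply/ffunP => i.
  by have := yy (invF hI i); rewrite !ffunE f_invF.
rewrite [RHS](reindex_inj cI) /=; apply: eq_bigr => y _; congr (_ * _).
by rewrite (reindex_inj hI) /=; apply: eq_bigr => i _; rewrite ffunE.
Qed.

Lemma Ex_prod_bool (J : finType) (q : J * bool -> T -> R)
    (P : {ffun J -> T} -> {ffun J -> T} -> R) :
  Ex q (fun y => P (comp_ffun y (fun v => (v, false))) (comp_ffun y (fun v => (v, true))))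
  = Ex (fun v => q (v, false)) (fun y0 => Ex (fun v => q (v, true)) (P y0)).
Proof.
rewrite /Ex; under [RHS]eq_bigr do rewrite mulr_sumr.
rewrite pair_big /=.
pose h (x : {ffun J -> T} * {ffun J -> T}) : {ffun J * bool -> T} :=
  [ffun i => if i.2 then x.2 i.1 else x.1 i.1].
pose g (y : {ffun J * bool -> T}) :=
  (comp_ffun y (fun v => (v, false)), comp_ffun y (fun v => (v, true))).
have hK : cancel h g.
  by case=> y0 y1; rewrite /h /g; congr pair; apply/ffunP => v; rewrite !ffunE.
have gK : cancel g h.
  by move=> y; apply/ffunP => -[v []]; rewrite !ffunE.
rewrite (reindex h) /=; last by exists g => x _; [exact: hK | exact: gK].
apply: eq_bigr => -[y0 y1] _ /=.
have /= := hK (y0, y1); rewrite /g => -[-> ->].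
rewrite mulrA; congr (_ * _).
rewrite (eq_bigr (fun i : J * bool => (fun v b => q (v, b) (h (y0, y1) (v, b))) i.1 i.2)); last
  by case.
rewrite -(pair_bigA _ (fun v b => q (v, b) (h (y0, y1) (v, b)))) /= -big_split /=.
by apply: eq_bigr => v _; rewrite big_bool !ffunE /= mulrC.
Qed.

End ProductExpectation.

(** * Noise stability and an Efron-Stein inequality *)

Section EfronStein.
Variables (R : realType) (T J A : finType).
Variables (q : J -> T -> R) (V : A -> {set J}) (p : R).
Hypothesis (hq : forall i, prob (q i)).
Hypothesis (p0 : 0 <= p).

Definition mix (B : {set J}) (y y' : {ffun J -> T}) : {ffun J -> T} :=
  [ffun i => if i \in B then y i else y' i].

Let q1 i : \sum_z q i z = 1. Proof. by case: (hq i). Qed.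

(** The correlation of [F] and [G] when the coordinates outside [B] are redrawn independently, that
    is, the inner product of their conditional expectations given the coordinates in [B]. *)
Definition stab (B : {set J}) (F G : {ffun J -> T} -> R) : R :=
  Ex q (fun y => Ex q (fun y' => F y * G (mix B y y'))).

Lemma mix_upd B y y' i z :
  mix B (upd y i z) y' = if i \in B then upd (mix B y y') i z else mix B y y'.
Proof.
apply/ffunP => j; case: ifP => iB; rewrite !ffunE; case: (eqVneq j i) => [->|//].
- by rewrite iB.
- by rewrite iB.
Qed.

Lemma mix_updr B y y' i z :
  mix B y (upd y' i z) = if i \in B then mix B y y' else upd (mix B y y') i z.
Proof.
apply/ffunP => j; case: ifP => iB; rewrite !ffunE; case: (eqVneq j i) => [->|//].
- by rewrite iB.
- by rewrite iB.
Qed.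

Lemma stabDl B F G H : stab B (fun y => F y + G y) H = stab B F H + stab B G H.
Proof.
rewrite /stab -ExD; apply: eq_Ex => y; rewrite -ExD; apply: eq_Ex => y'.
by rewrite mulrDl.
Qed.

Lemma stabDr B F G H : stab B H (fun y => F y + G y) = stab B H F + stab B H G.
Proof.
rewrite /stab -ExD; apply: eq_Ex => y; rewrite -ExD; apply: eq_Ex => y'.
by rewrite mulrDr.
Qed.

(** Exchanging the coordinates outside [B] between two independent samples preserves their joint
    law. *)
Lemma Ex_mix B F : Ex q (fun y => Ex q (fun y' => F (mix B y y'))) = Ex q F.
Proof.
pose Q (x : {ffun J -> T} * {ffun J -> T}) := (mix B x.1 x.2, mix B x.2 x.1).
have QK : involutive Q.
  by case=> y y'; rewrite /Q /=; congr pair; apply/ffunP => i; rewrite !ffunE; case: (i \in B).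
rewrite {1}/Ex; under eq_bigr do rewrite mulr_sumr.
rewrite pair_big /= (reindex_inj (inv_inj QK)) /=.
rewrite (eq_bigr (fun x : {ffun J -> T} * {ffun J -> T} =>
  (\prod_i q i (x.2 i)) * ((\prod_i q i (x.1 i)) * F x.1))).
  rewrite -(pair_bigA _ (fun y y' : {ffun J -> T} =>
    (\prod_i q i (y' i)) * ((\prod_i q i (y i)) * F y))) /=.
  apply: eq_bigr => y _; rewrite -mulr_suml.
  rewrite -(bigA_distr_bigA (fun i z => q i z)) [X in X * _]big1 ?mul1r//.
move=> [y y'] _ /=; rewrite !mulrA -!big_split /=; congr (_ * _); last first.
  by congr F; apply/ffunP => i; rewrite !ffunE; case: (i \in B).
by apply: eq_bigr => i _; rewrite !ffunE; case: ifP => // _; rewrite mulrC.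
Qed.

Lemma stab_le B F : stab B F F <= Ex q (fun y => F y ^+ 2).
Proof.
have -> : Ex q (fun y => F y ^+ 2) =
  Ex q (fun y => Ex q (fun y' => (F y ^+ 2 + F (mix B y y') ^+ 2) / 2)).
  have -> : Ex q (fun y => Ex q (fun y' => (F y ^+ 2 + F (mix B y y') ^+ 2) / 2)) =
    2^-1 * (Ex q (fun y => F y ^+ 2) + Ex q (fun y => Ex q (fun y' => F (mix B y y') ^+ 2))).
    rewrite -ExD -ExZ; apply: eq_Ex => y.
    rewrite -[X in _ * (X + _)](@Ex_cst _ _ _ q) // -ExD -ExZ.
    by apply: eq_Ex => y'; rewrite mulrC.
  by rewrite (Ex_mix B (fun y => F y ^+ 2)); field.
apply: ler_Ex => // y; apply: ler_Ex => // y'.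
have := sqr_ge0 (F y - F (mix B y y')); nra.
Qed.

Section Step.
Variables (i : J) (F : {ffun J -> T} -> R).

Definition avg (y : {ffun J -> T}) := \sum_z q i z * F (upd y i z).

Let H y := F y - avg y.

Lemma avg_upd y z : avg (upd y i z) = avg y.
Proof. by apply: eq_bigr => z' _; rewrite upd_upd. Qed.

Lemma avg_res0 y : \sum_z q i z * H (upd y i z) = 0.
Proof.
under eq_bigr do rewrite /H avg_upd mulrBr.
by rewrite sumrB -mulr_suml q1 mul1r subrr.
Qed.

(** [avg] ignores coordinate [i], and [H] averages to zero over it. The copy of coordinate [i] seen
    by [H] belongs to [y] if [i] is in [B] and to [y'] otherwise; averaging over that copy kills the
    product. *)
Lemma stab_avgl B : stab B avg H = 0.
Proof.
case iB: (i \in B).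
  apply: (Ex_eq0 (q1 i)) => y; under eq_bigr do rewrite -ExZ.
  rewrite -Ex_sum; apply: big1 => y' _.
  rewrite [X in _ * X](_ : _ = 0) ?mulr0 //.
  under eq_bigr do rewrite avg_upd mix_upd iB mulrCA.
  by rewrite -mulr_sumr avg_res0 mulr0.
apply: big1 => y _; rewrite (Ex_eq0 (q1 i)) ?mulr0 // => y'.
under eq_bigr do rewrite mix_updr iB mulrCA.
by rewrite -mulr_sumr avg_res0 !mulr0.
Qed.

Lemma stab_avgr B : stab B H avg = 0.
Proof.
apply: (Ex_eq0 (q1 i)) => y; under eq_bigr do rewrite -ExZ.
rewrite -Ex_sum; apply: big1 => y' _.
rewrite [X in _ * X](_ : _ = 0) ?mulr0 //.
under eq_bigr do rewrite mix_upd fun_if avg_upd if_same mulrA.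
by rewrite -mulr_suml avg_res0 mul0r.
Qed.

Lemma stab_res0 (B : {set J}) : i \notin B -> stab B H H = 0.
Proof.
move=> /negPf iB; apply: (Ex_eq0 (q1 i)) => y; under eq_bigr do rewrite -ExZ.
rewrite -Ex_sum; apply: big1 => y' _.
rewrite [X in _ * X](_ : _ = 0) ?mulr0 //.
under eq_bigr do rewrite mix_upd iB mulrA.
by rewrite -mulr_suml avg_res0 mul0r.
Qed.

(** The cross terms of [F = avg + H] vanish. The term in [H] alone vanishes if coordinate [i] is
    redrawn and is bounded by Cauchy-Schwarz if it is kept. *)
Lemma stab_step (B : {set J}) :
  stab B F F <= stab B avg avg + (i \in B)%:R * Ex q (fun y => H y ^+ 2).
Proof.
have E : stab B F F = stab B (fun y => avg y + H y) (fun y => avg y + H y).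
  by rewrite /stab; apply: eq_Ex => y; apply: eq_Ex => y'; rewrite /H ![avg _ + _]addrC !subrK.
rewrite E (stabDl B avg H) (stabDr B avg H avg) (stabDr B avg H H).
rewrite stab_avgl stab_avgr addr0 add0r lerD2l.
case: (boolP (i \in B)) => iB; rewrite ?mul1r ?mul0r ?stab_le //.
by rewrite stab_res0.
Qed.

Lemma Ex_avg : Ex q avg = Ex q F.
Proof. by rewrite -Ex_resample_id. Qed.

Lemma Ex_sqr_avg : Ex q (fun y => F y ^+ 2) = Ex q (fun y => avg y ^+ 2) + Ex q (fun y => H y
  ^+ 2).
Proof.
have Z : Ex q (fun y => avg y * H y) = 0.
  apply: (Ex_eq0 (q1 i)) => y; under eq_bigr do rewrite avg_upd mulrCA.
  by rewrite -mulr_sumr avg_res0 mulr0.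
have := ExZ q (fun y => avg y * H y) 2; rewrite Z mulr0 => Z2.
rewrite -[LHS]subr0 -Z2 -ExB -ExD.
by apply: eq_Ex => y; rewrite /H; ring.
Qed.

End Step.

(* Removing one coordinate [i] at a time, [F] splits orthogonally into its
   average over [i] and a remainder that only the sets [V a] containing [i] see. *)
Lemma avg_stab_le (D : {set J}) F :
  (forall i, i \in D -> (#|[set a | i \in V a]|)%:R <= p * #|A|%:R) ->
  (forall i y z, i \notin D -> F (upd y i z) = F y) ->
  #|A|%:R^-1 * \sum_a stab (V a) F F <=
  Ex q F ^+ 2 + p * (Ex q (fun y => F y ^+ 2) - Ex q F ^+ 2).
Proof.
case: (posnP #|A|) => [A0 _ _|A0].
  rewrite A0 invr0 mul0r addr_ge0 ?sqr_ge0 // mulr_ge0 //.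
  have -> : Ex q (fun y => F y ^+ 2) - Ex q F ^+ 2 = Ex q (fun y => (F y - Ex q F) ^+ 2).
    transitivity (Ex q (fun y => F y ^+ 2) + (Ex q (fun=> Ex q F ^+ 2) - Ex q (fun y => 2 * Ex
      q F * F y))).
      by rewrite Ex_cst // ExZ; ring.
    by rewrite -ExB -ExD; apply: eq_Ex => y; ring.
  by apply: Ex_ge0 => // y; exact: sqr_ge0.
have Ap : 0 < #|A|%:R :> R by rewrite ltr0n.
(* The function varies along the induction: each step replaces it by its average over one coordinate
   of [D]. *)
elim: {D}#|D| {-2}D (erefl #|D|) F => [|n IHn] D cD G hV hG.
    have D0 : D = finset.set0 by apply/eqP; rewrite -cards_eq0 cD.
    have Gc y y' : G y = G y'.
      have {}hG i z x : G (upd x i z) = G x by apply: hG; rewrite D0 inE.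
      (* With [D] empty, no single update changes [G]; updating the coordinates one by one shows
         that [G] is constant. *)
      have step (s : seq J) : G [ffun i => if i \in s then y i else y' i] = G y'.
        elim: s => [|i s IHs]; first by congr G; apply/ffunP => i; rewrite ffunE.
        rewrite -IHs -[RHS](hG i (y i)); congr G; apply/ffunP => j.
        by rewrite !ffunE inE; case: eqP => // ->.
      rewrite -(step (enum J)); congr G; apply/ffunP => i.
      by rewrite ffunE mem_enum.
    (* The constant is named by a sample point [y0]; without any sample point all expectations are
       empty sums. *)
    have [y0 _|noy] := pickP (fun y : {ffun J -> T} => true); last first.
      have E0 (K : {ffun J -> T} -> R) : Ex q K = 0.
        by apply: big1 => y; have := noy y.
      rewrite !E0 big1 ?mulr0 ?expr0n /= ?subr0 ?mulr0 ?addr0 // => a _.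
      exact: E0.
    have sE a : stab (V a) G G = G y0 ^+ 2.
      rewrite /stab (@eq_Ex _ _ _ _ _ (fun=> G y0 ^+ 2)) ?Ex_cst // => y.
      rewrite (@eq_Ex _ _ _ _ _ (fun=> G y0 ^+ 2)) ?Ex_cst // => y'.
      by rewrite (Gc y y0) (Gc _ y0) expr2.
    rewrite (eq_bigr (fun=> G y0 ^+ 2)) // sumr_const.
    rewrite (@eq_Ex _ _ _ _ G (fun=> G y0)) // (@eq_Ex _ _ _ _ (fun y => G y ^+ 2) (fun=> G y0
      ^+ 2)); last first.
      by move=> y; rewrite (Gc y y0).
    by rewrite !Ex_cst // subrr mulr0 addr0 -[G y0 ^+ 2 *+ _]mulr_natl mulKf ?lexx // lt0r_neq0.
  have /set0Pn [i iD] : D != finset.set0 by rewrite -cards_eq0 cD.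
  have cD' : #|D :\ i| = n by have := cardsD1 i D; rewrite iD cD => -[].
  have hA j y z : j \notin D :\ i -> avg i G (upd y j z) = avg i G y.
    rewrite !inE negb_and negbK => /orP[/eqP ->|jD]; first exact: avg_upd.
    have ij : j != i by apply: contraNneq jD => ->.
    apply: eq_bigr => x _; congr (_ * _); rewrite -[RHS](hG j _ z jD); congr G.
    apply/ffunP => k; rewrite !ffunE; case: eqP => // ->.
    by rewrite eq_sym (negPf ij).
  have hV' j : j \in D :\ i -> (#|[set a | j \in V a]|)%:R <= p * #|A|%:R.
    by rewrite !inE => /andP[_ jD]; exact: hV.
  have IH := IHn _ cD' _ hV' hA; rewrite Ex_avg in IH.
  rewrite (Ex_sqr_avg i G).
  set h2 := Ex q (fun y => (_ - _) ^+ 2).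
  have h20 : 0 <= h2 by apply: Ex_ge0 => // y; exact: sqr_ge0.
  have : #|A|%:R^-1 * \sum_a stab (V a) G G <=
         #|A|%:R^-1 * \sum_a stab (V a) (avg i G) (avg i G) + p * h2.
    apply: (@le_trans _ _ (#|A|%:R^-1 * \sum_a (stab (V a) (avg i G) (avg i G) + (i \in V a)%:R
      * h2))).
      by apply: ler_wpM2l; [rewrite invr_ge0 ltW | apply: ler_sum => a _; exact: stab_step].
    rewrite big_split /= mulrDr lerD2l -mulr_suml mulrA ler_wpM2r //.
    rewrite mulrC ler_pdivrMr // (le_trans _ (hV i iD)) //.
    by rewrite -natr_sum ler_nat -big_mkcond /= sum1_card cardsE.
  lra.
Qed.

End EfronStein.

(** * Mean values, and derivatives of finite sums and products *)

Section Calculus.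
Variable R : realType.

Lemma mean_value (f df : R -> R) (a b : R) : a < b ->
  (forall x : R, is_derive x 1 f (df x)) ->
  exists c, [/\ a < c, c < b & f b - f a = df c * (b - a)].
Proof.
move=> ab dF; have [|c] := MVT ab (fun x _ => dF x).
  by apply: derivable_within_continuous => x _; case: (dF x).
by rewrite in_itv /= => /andP[ac cb] E; exists c.
Qed.

Lemma is_derive_bigsum (A : Type) (r : seq A) (f : A -> R -> R) (df : A -> R) (t : R) :
  (forall a, is_derive t 1 (f a) (df a)) ->
  is_derive t 1 (fun t => \sum_(a <- r) f a t) (\sum_(a <- r) df a).
Proof.
move=> hf; elim: r => [|a r IH].
  rewrite big_nil (_ : (fun _ => _) = cst 0); first exact: is_derive_cst.
  by apply/funext => x; rewrite big_nil.
rewrite big_cons (_ : (fun _ => _) = f a + (fun t => \sum_(a <- r) f a t)).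
  exact: is_deriveD.
by apply/funext => x; rewrite big_cons.
Qed.

(** Each term of the Leibniz rule is kept as a full product with one factor replaced, which is the
    shape of a product weight with one marginal changed. The replaced factor is recognized by its
    index, whence [uniq]. *)
Lemma is_derive_bigprod (A : eqType) (r : seq A) (f : A -> R -> R) (df : A -> R) (t : R) :
  uniq r -> (forall a, is_derive t 1 (f a) (df a)) ->
  is_derive t 1 (fun t => \prod_(a <- r) f a t)
    (\sum_(a <- r) \prod_(b <- r) (if b == a then df a else f b t)).
Proof.
move=> + hf; elim: r => [_|a r IH /= /andP[ar /IH {}IH]].
  rewrite big_nil (_ : (fun _ => _) = cst 1); first exact: is_derive_cst.
  by apply/funext => x; rewrite big_nil.
rewrite (_ : (fun _ => _) = f a * (fun t => \prod_(a <- r) f a t)); last first.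
  by apply/funext => x; rewrite big_cons.
apply: (is_derive_eq (is_deriveM (hf a) IH)); rewrite -![_ *: _]/(_ * _).
rewrite big_cons addrC /= big_cons eqxx; congr (_ + _).
  rewrite mulrC; congr (_ * _); apply: eq_big_seq => b br.
  by case: eqP => // ba; rewrite -ba br in ar.
rewrite mulr_sumr; apply: eq_big_seq => b br; rewrite big_cons.
by case: eqP => // ba; rewrite ba br in ar.
Qed.

End Calculus.

(** * Linear codes on symmetric channels *)

Lemma ln_le_sub1 (R : realType) (x : R) : 0 < x -> ln x <= x - 1.
Proof. by move=> x0; have := @le_ln1Dx R (x - 1); rewrite addrCA subrr addr0; apply; lra. Qed.

(* [ln t = 2 ln (sqrt t)] turns [ln t <= t - 1] into a Hellinger-type bound. *)
Lemma gibbs_pt (R : realType) (a b M : R) : 0 < a -> 0 < b -> a <= M -> b <= M ->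
  (a - b) ^+ 2 / (4 * M) <= a * ln (a / b) - a + b.
Proof.
move=> a0 b0 aM bM.
have sa0 : 0 < Num.sqrt a by rewrite sqrtr_gt0.
have sb0 : 0 < Num.sqrt b by rewrite sqrtr_gt0.
have Ea : a = Num.sqrt a ^+ 2 by rewrite sqr_sqrtr // ltW.
have Eb : b = Num.sqrt b ^+ 2 by rewrite sqr_sqrtr // ltW.
set x := Num.sqrt a in sa0 Ea *; set y := Num.sqrt b in sb0 Eb *.
have H : 2 * (1 - y / x) <= ln (a / b).
  have := ln_le_sub1 (divr_gt0 sb0 sa0).
  have -> : ln (a / b) = - (2 * ln (y / x)).
    rewrite Ea Eb -expr_div_n lnXn ?divr_gt0 // -[x / y]invrK invf_div lnV ?posrE ?divr_gt0 //.
    by rewrite mulr2n; ring.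
  lra.
have {}H : (x - y) ^+ 2 <= a * ln (a / b) - a + b.
  have := ler_wpM2l (ltW a0) H.
  have -> : a * (2 * (1 - y / x)) = 2 * a - 2 * x * y by rewrite Ea; field; rewrite lt0r_neq0.
  by rewrite {1 3 5}Ea {1 2}Eb; nra.
apply: le_trans H.
have M0 : 0 < M by exact: lt_le_trans aM.
rewrite ler_pdivrMr ?mulr_gt0 //.
(* The constant 4 comes from [(x + y)^2 <= 2 (x^2 + y^2) = 2 (a + b) <= 4 M]. *)
have -> : (a - b) ^+ 2 = (x - y) ^+ 2 * (x + y) ^+ 2 by rewrite Ea Eb; ring.
rewrite ler_wpM2l ?sqr_ge0 //.
by have := sqr_ge0 (x - y); rewrite Ea in aM; rewrite Eb in bM; nra.
Qed.

Section SymmetricChannel.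
Variables (R : realType) (T : finType) (s : T -> T) (l : T -> R).
Hypothesis (sK : involutive s).
Hypothesis (l_gt0 : forall z, 0 < l z).
Hypothesis (l_s : forall z, l (s z) = (l z)^-1).

(* [p] is the output law given the input bit 0, [l] the likelihood ratio of
   the input bits 1 and 0, and [s] the involution exchanging the two laws. *)
Definition symlaw (p : T -> R) := prob p /\ forall z, p (s z) = p z * l z.

Section Code.
Variables (I : finType) (C : {set {ffun I -> bool}}).

Definition cadd (u v : {ffun I -> bool}) : {ffun I -> bool} :=
  [ffun i => u i (+) v i].

Definition linear_code :=
  [ffun=> false] \in C /\ (forall u v, u \in C -> v \in C -> cadd u v \in C).

Definition flip (u : {ffun I -> bool}) (y : {ffun I -> T}) : {ffun I -> T} :=
  [ffun i => if u i then s (y i) else y i].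

(** The likelihood of the codeword [u] relative to the zero codeword. *)
Definition wt (u : {ffun I -> bool}) (y : {ffun I -> T}) : R :=
  \prod_i (if u i then l (y i) else 1).

Definition Zsum (y : {ffun I -> T}) : R := \sum_(u in C) wt u y.

Definition Dsum (o : I) (y : {ffun I -> T}) : R :=
  \sum_(u in C) (-1) ^+ (u o) * wt u y.

(** The posterior mean of the sign [(-1)^(u o)] for a uniform codeword [u]. *)
Definition pmean (o : I) (y : {ffun I -> T}) : R := Dsum o y / Zsum y.

Definition equivariant (o : I) (g : {ffun I -> T} -> R) :=
  forall v y, v \in C -> g (flip v y) = (-1) ^+ (v o) * g y.

Hypothesis (Clin : linear_code).

Let C0 : [ffun=> false] \in C. Proof. by case: Clin. Qed.
Let CD u v : u \in C -> v \in C -> cadd u v \in C. Proof. by case: Clin => _; apply. Qed.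

Lemma cardC_gt0 : 0 < #|C|%:R :> R.
Proof. by rewrite ltr0n; apply/card_gt0P; exists [ffun=> false]. Qed.

Lemma caddK v : involutive (cadd^~ v).
Proof. by move=> u; apply/ffunP => i; rewrite !ffunE addbK. Qed.

Lemma wt_gt0 u y : 0 < wt u y.
Proof. by apply: prodr_gt0 => i _; case: ifP. Qed.

Lemma wt0 y : wt [ffun=> false] y = 1.
Proof. by apply: big1 => i _; rewrite ffunE. Qed.

Lemma wt_flip u v y : wt u (flip v y) * wt v y = wt (cadd u v) y.
Proof.
rewrite /wt -big_split /=; apply: eq_bigr => i _; rewrite !ffunE.
by case: (v i); case: (u i); rewrite /= ?l_s ?mulVf ?mul1r ?mulr1 ?lt0r_neq0.
Qed.

Lemma Zsum_ge1 y : 1 <= Zsum y.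
Proof.
rewrite /Zsum (bigD1 _ C0) /= wt0 lerDl; apply: sumr_ge0 => u _.
exact/ltW/wt_gt0.
Qed.

Lemma Zsum_gt0 y : 0 < Zsum y.
Proof. exact: lt_le_trans ltr01 (Zsum_ge1 y). Qed.

Lemma reindex_cadd v (F : {ffun I -> bool} -> R) : v \in C ->
  \sum_(u in C) F u = \sum_(u in C) F (cadd u v).
Proof.
move=> vC; rewrite (reindex_inj (inv_inj (caddK v))) /=; apply: eq_bigl => u.
by apply/idP/idP => uC; [rewrite -(caddK v u) /= |]; apply: CD.
Qed.

Lemma Zsum_flip v y : v \in C -> Zsum (flip v y) * wt v y = Zsum y.
Proof.
move=> vC; rewrite mulr_suml [RHS](reindex_cadd _ vC).
by apply: eq_bigr => u _; rewrite wt_flip.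
Qed.

Lemma Dsum_flip o v y : v \in C -> Dsum o (flip v y) * wt v y = (-1) ^+ (v o) * Dsum o y.
Proof.
move=> vC; rewrite /Dsum mulr_suml [X in _ = _ * X](reindex_cadd _ vC) mulr_sumr.
apply: eq_bigr => u _; rewrite -mulrA wt_flip mulrA; congr (_ * _).
by rewrite ffunE signr_addb mulrCA -expr2 sqrr_sign mulr1.
Qed.

Lemma pmean_equivariant o : equivariant o (pmean o).
Proof.
move=> v y vC; rewrite /pmean mulrA -(Dsum_flip _ _ vC) -(Zsum_flip y vC).
by rewrite invfM mulrACA mulfV ?mulr1 // lt0r_neq0 // wt_gt0.
Qed.

Lemma pmean_le1 o y : `|pmean o y| <= 1.
Proof.
rewrite normrM normfV (gtr0_norm (Zsum_gt0 y)) ler_pdivrMr ?Zsum_gt0 // mul1r.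
apply: le_trans (ler_norm_sum _ _ _) _; apply: ler_sum => u _.
by rewrite normrM normr_sign mul1r gtr0_norm ?wt_gt0.
Qed.

Lemma flipK u : involutive (flip u).
Proof. by move=> y; apply/ffunP => i; rewrite !ffunE; case: (u i). Qed.

Section Law.
Variable q : I -> T -> R.
Hypothesis (hq : forall i, symlaw (q i)).

Let q1 i : \sum_z q i z = 1. Proof. by case: (hq i) => -[]. Qed.
Let qprob i : prob (q i). Proof. by case: (hq i). Qed.

(* Weighting by [wt v] turns the outputs of the zero codeword into those of [v]. *)
Lemma Ex_wt v F : Ex q (fun y => wt v y * F y) = Ex q (fun y => F (flip v y)).
Proof.
rewrite /Ex [RHS](reindex_inj (inv_inj (flipK v))) /=.
apply: eq_bigr => y _; rewrite flipK mulrA -big_split /=; congr (_ * _).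
apply: eq_bigr => i _; rewrite ffunE; case: ifP => _; last by rewrite mulr1.
by case: (hq i) => _ ->.
Qed.

(** [Zsum / #|C|] is the density of the output law of a random codeword with respect to that of the
    zero codeword. A function invariant under flips by codewords has the same mean under both. *)
Lemma Ex_Zsum_inv F : (forall v y, v \in C -> F (flip v y) = F y) ->
  Ex q (fun y => Zsum y * F y) = #|C|%:R * Ex q F.
Proof.
move=> hF; under eq_Ex do rewrite mulr_suml.
rewrite Ex_sum (eq_bigr (fun=> Ex q F)) ?sumr_const ?mulr_natl // => u uC.
by rewrite Ex_wt; apply: eq_Ex => y; rewrite hF.
Qed.

(** For a random codeword, the transmitted sign times [g] has the mean that [g] has under the zero
    codeword. Conditioning on the output replaces the sign by its posterior mean, and the product is
    then flip-invariant. *)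
Lemma Ex_pmean_mul o g : equivariant o g ->
  Ex q (fun y => pmean o y * g y) = Ex q g.
Proof.
move=> hg; have Cp := cardC_gt0; apply: (mulfI (lt0r_neq0 Cp)).
rewrite -Ex_Zsum_inv; last first.
  move=> v y vC; rewrite hg // (pmean_equivariant _ _ vC) mulrACA -expr2.
  by rewrite sqrr_sign mul1r.
under eq_Ex => y.
  rewrite mulrA /pmean mulrCA mulfV ?lt0r_neq0 ?Zsum_gt0 // mulr1 mulr_suml.
  under eq_bigr do rewrite -mulrA mulrCA.
  over.
rewrite Ex_sum (eq_bigr (fun=> Ex q g)) ?sumr_const ?mulr_natl // => u uC.
rewrite (Ex_wt u (fun y => (-1) ^+ u o * g y)).
by apply: eq_Ex => y; rewrite hg // mulrA -expr2 sqrr_sign mul1r.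
Qed.

(** The Nishimori identity: the previous lemma with [g] the posterior mean itself. *)
Lemma Ex_pmean_sqr o : Ex q (fun y => pmean o y ^+ 2) = Ex q (pmean o).
Proof.
rewrite -(Ex_pmean_mul (@pmean_equivariant o)).
by apply: eq_Ex => y; rewrite expr2.
Qed.

Variable p : T -> R.
Hypothesis (hp : symlaw p).

Let pge0 z : 0 <= p z. Proof. by case: hp => -[]. Qed.
Let p1 : \sum_z p z = 1. Proof. by case: hp => -[]. Qed.
Let ps z : p (s z) = p z * l z. Proof. by case: hp. Qed.

(** The likelihood of output [z], relative to input bit 0, when the sign of the bit has prior mean
    [x]. *)
Definition lmix (z : T) (x : R) := ((1 + x) + (1 - x) * l z) / 2.

(** The mean information density, in nats, of a use of [p] with input bit 0 and prior mean [x]; in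
    particular [phi 0] is the capacity of [p]. *)
Definition phi (x : R) := - \sum_z p z * ln (lmix z x).

(** The modulus of strong convexity obtained in [gibbs_sep]; it measures how far [p] is from a
    useless channel. *)
Definition sep := \sum_z p z * ((1 - l z) ^+ 2 / (16 * (1 + l z))).

Lemma sump_l : \sum_z p z * l z = 1.
Proof. by rewrite -[RHS]p1 [RHS](reindex_inj (inv_inj sK)); apply: eq_bigr => z _; rewrite ps.
  Qed.

Lemma lmix_gt0 z (x : R) : `|x| <= 1 -> 0 < lmix z x.
Proof.
rewrite ler_norml => /andP[x1 x2]; rewrite divr_gt0 //; have := l_gt0 z => lz.
have [x0|x0] := lerP 0 x; first by apply: ltr_wpDr; [apply: mulr_ge0; lra | lra].
by apply: ltr_wpDl; [lra | apply: mulr_gt0; lra].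
Qed.

Lemma lmixN z x : lmix z (- x) = l z * lmix (s z) x.
Proof. by rewrite /lmix l_s opprK; field; rewrite lt0r_neq0. Qed.

Lemma sump_lmix x : \sum_z p z * lmix z x = 1.
Proof.
under eq_bigr do rewrite /lmix mulrA mulrDr (mulrCA (p _)).
by rewrite -mulr_suml big_split /= -mulr_suml -mulr_sumr sump_l p1; field.
Qed.

Lemma lmix_le z (x : R) : `|x| <= 1 -> lmix z x <= 1 + l z.
Proof.
rewrite ler_norml => /andP[x1 x2]; rewrite ler_pdivrMr //; have := l_gt0 z.
nra.
Qed.

(** The right side is the relative entropy of two output laws. Both have mass 1, so the linear terms
    of [gibbs_pt] can be added for free. Taking [M = 1 + l z] and a difference of
    [(x - y) (1 - l z) / 2] gives the constant 16. *)
Lemma gibbs_sep (x y : R) : `|x| <= 1 -> `|y| <= 1 ->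
  sep * (x - y) ^+ 2 <= \sum_z p z * (lmix z x * ln (lmix z x / lmix z y)).
Proof.
move=> hx hy; rewrite /sep mulr_suml.
have -> : \sum_z p z * (lmix z x * ln (lmix z x / lmix z y)) =
  \sum_z p z * (lmix z x * ln (lmix z x / lmix z y) - lmix z x + lmix z y).
  under [RHS]eq_bigr do rewrite mulrDr mulrBr.
  by rewrite big_split /= sumrB !sump_lmix subrK.
apply: ler_sum => z _; rewrite -mulrA ler_wpM2l //.
apply: le_trans (gibbs_pt (lmix_gt0 z hx) (lmix_gt0 z hy) (lmix_le z hx) (lmix_le z hy)).
have -> : lmix z x - lmix z y = (x - y) * (1 - l z) / 2 by rewrite /lmix; field.
have lz := l_gt0 z.
have l1 : 1 + l z != 0 by rewrite lt0r_neq0 // addr_gt0.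
by rewrite le_eqVlt; apply/orP; left; apply/eqP; field.
Qed.

(* Averaging over the transmitted codeword symmetrizes the integrand into a
   relative entropy, to which [gibbs_sep] applies pointwise. *)
Lemma phi_sep o g : equivariant o g -> (forall y, `|g y| <= 1) ->
  sep * Ex q (fun y => (pmean o y - g y) ^+ 2) <=
  Ex q (fun y => phi (g y)) - Ex q (fun y => phi (pmean o y)).
Proof.
move=> hg g1; set f := pmean o.
pose h x y := \sum_z p z * ln (lmix z x / lmix z y).
have hE x y : `|x| <= 1 -> `|y| <= 1 -> phi y - phi x = h x y.
  move=> x1 y1; rewrite /phi opprK addrC -sumrB; apply: eq_bigr => z _.
  by rewrite -mulrBr ln_div // posrE lmix_gt0.
(* Negating both means amounts to sending the bit 1, whose output law is [p] reweighted by [l]. *)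
have hN x y : `|x| <= 1 -> `|y| <= 1 ->
    h (- x) (- y) = \sum_z p z * (l z * ln (lmix z x / lmix z y)).
  move=> x1 y1; rewrite /h (reindex_inj (inv_inj sK)) /=; apply: eq_bigr => z _.
  rewrite ps -mulrA; congr (_ * (_ * ln _)); rewrite !lmixN sK l_s.
  by rewrite -mulf_div mulfV ?mul1r // invr_neq0 // lt0r_neq0.
rewrite -ExB; under [X in _ <= X]eq_Ex do rewrite (hE _ _ (pmean_le1 o _) (g1 _)).
have Cp := cardC_gt0; rewrite -(ler_pM2l Cp).
have -> : #|C|%:R * Ex q (fun y => h (f y) (g y)) =
   Ex q (fun y => Zsum y * \sum_z p z * (lmix z (f y) * ln (lmix z (f y) / lmix z (g y)))).
  (* By [Ex_wt] and equivariance, every codeword contributes the same term. *)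
  transitivity (\sum_(u in C) Ex q (fun y => wt u y * h ((-1) ^+ u o * f y) ((-1) ^+ u o * g y))).
    rewrite (eq_bigr (fun=> Ex q (fun y => h (f y) (g y)))) ?sumr_const ?mulr_natl //.
    move=> u uC; rewrite (Ex_wt u (fun y => h ((-1) ^+ u o * f y) ((-1) ^+ u o * g y))).
    apply: eq_Ex => y; rewrite hg // /f (pmean_equivariant _ _ uC).
    by rewrite !mulrA -expr2 sqrr_sign !mul1r.
  rewrite -Ex_sum; apply: eq_Ex => y.
  have f1 := pmean_le1 o y; have gy1 := g1 y.
  pose h0 := h (f y) (g y); pose h1 := h (- f y) (- g y).
  transitivity (\sum_(u in C) (wt u y * ((h0 + h1) / 2) + (-1) ^+ u o * wt u y * ((h0 - h1) /
    2))).
    apply: eq_bigr => u _; case: (u o); rewrite ?expr1 ?expr0 ?mulN1r ?mul1r -/h0 -/h1; by field.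
  rewrite big_split /= -!mulr_suml -/(Zsum y) -/(Dsum o y).
  have -> : Dsum o y = Zsum y * f y by rewrite /f /pmean mulrCA mulfV ?mulr1 // lt0r_neq0 //
    Zsum_gt0.
  (* The coefficients of [h0] and [h1] are the posterior probabilities of the two bit values, so the
     two sums over [z] merge into one weighted by [lmix z (f y)]. *)
  transitivity (Zsum y * ((1 + f y) / 2 * h0 + (1 - f y) / 2 * h1)); first by field.
  congr (_ * _); rewrite /h0 /h1 hN // /h !mulr_sumr -big_split /=; apply: eq_bigr => z _.
  by rewrite /lmix; field.
rewrite -(ExZ q (fun y => (f y - g y) ^+ 2)) -Ex_Zsum_inv; last first.
  move=> v y vC; rewrite hg // /f (pmean_equivariant _ _ vC) -mulrBr exprMn.
  by rewrite sqrr_sign mul1r.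
apply: ler_Ex => // y; rewrite ler_wpM2l //; first exact/ltW/Zsum_gt0.
by apply: gibbs_sep => //; exact: pmean_le1.
Qed.

(* The tangent of the convex function [phi] at [0]. *)
Lemma phi_ge (x : R) : `|x| <= 1 -> phi 0 - x * \sum_z p z * ((1 - l z) / (1 + l z)) <= phi x.
Proof.
move=> x1; rewrite /phi mulr_sumr -opprD lerN2 -big_split /=; apply: ler_sum => z _.
have lz := l_gt0 z; have l1 : 0 < 1 + l z by rewrite addr_gt0.
have m0 : lmix z 0 = (1 + l z) / 2 by rewrite /lmix addr0 subr0 mul1r.
have m0p : 0 < lmix z 0 by rewrite m0 divr_gt0.
rewrite mulrCA -mulrDr ler_wpM2l // -lerBlDl -ln_div ?posrE ?lmix_gt0 ?normr0 ?ler01 //.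
apply: le_trans (ln_le_sub1 (divr_gt0 (lmix_gt0 z x1) m0p)) _.
rewrite le_eqVlt; apply/orP; left; apply/eqP; rewrite m0 /lmix; field.
by rewrite lt0r_neq0.
Qed.

(** The tangent at 0 has slope at least -1, and the mean of [pmean] is nonnegative by the Nishimori
    identity. *)
Lemma Ex_phi_ge o : phi 0 - Ex q (pmean o) <= Ex q (fun y => phi (pmean o y)).
Proof.
pose d := \sum_z p z * ((1 - l z) / (1 + l z)).
have d1 : d <= 1.
  rewrite -p1; apply: ler_sum => z _; rewrite -[leRHS]mulr1 ler_wpM2l //.
  by have lz := l_gt0 z; rewrite ler_pdivrMr; lra.
have m0 : 0 <= Ex q (pmean o).
  by rewrite -Ex_pmean_sqr; apply: Ex_ge0 => // y; exact: sqr_ge0.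
apply: (@le_trans _ _ (Ex q (fun y => phi 0 - d * pmean o y))).
  by rewrite ExB ExZ Ex_cst // lerD2l lerN2 ler_piMl.
by apply: ler_Ex => // y; rewrite mulrC; apply: phi_ge; exact: pmean_le1.
Qed.

End Law.
End Code.

(** * The erasure path *)

Section Erasure.
Variables (e : T) (p : T -> R).
Hypothesis (se : s e = e).
Hypothesis (hp : symlaw p).

Let pp : prob p. Proof. by case: hp. Qed.
Let p1 : \sum_z p z = 1. Proof. by case: pp. Qed.

Definition pt_mass (z : T) : R := (z == e)%:R.

(** The symbols in [O] are always erased, the others with probability [1 - t]. A fixed point [e] of
    [s] can play the erasure because [l e = 1] there. *)
Definition elaw (I : finType) (O : {set I}) (t : R) (i : I) (z : T) : R :=
  if i \in O then pt_mass z else (1 - t) * pt_mass z + t * p z.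

Lemma l_e : l e = 1.
Proof.
have := l_s e; rewrite se => le; have lp := l_gt0 e.
have : l e * l e = 1 by rewrite {1}le mulVf // lt0r_neq0.
by move/eqP; rewrite -expr2 sqrf_eq1 => /orP[/eqP //|/eqP E]; rewrite E in lp; lra.
Qed.

Lemma sum_pt_mass (F : T -> R) : \sum_z pt_mass z * F z = F e.
Proof.
rewrite (bigD1 e) //= /pt_mass eqxx mul1r big1 ?addr0 // => z /negPf ->.
by rewrite mul0r.
Qed.

Lemma pt_mass_sym : symlaw pt_mass.
Proof.
split; first split.
- by move=> z; rewrite /pt_mass ler0n.
- by under eq_bigr do rewrite -[pt_mass _]mulr1; rewrite (sum_pt_mass (fun=> 1)).
- move=> z; rewrite /pt_mass -{1}se (inj_eq (inv_inj sK)).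
  by case: eqP => [->|_]; rewrite ?l_e ?mulr1 // mul0r.
Qed.

Lemma sum_elaw (I : finType) (O : {set I}) t i : \sum_z elaw O t i z = 1.
Proof.
rewrite /elaw; have [[_ d1] _] := pt_mass_sym; case: (i \in O) => //.
by rewrite big_split /= -!mulr_sumr d1 p1; ring.
Qed.

Lemma elaw_sym (I : finType) (O : {set I}) (t : R) i : 0 <= t <= 1 -> symlaw (elaw O t i).
Proof.
move=> /andP[t0 t1]; have [[d0 d1] dl] := pt_mass_sym; have [[p0 _] pl] := hp.
split; first split; last 2 first.
- exact: sum_elaw.
- by move=> z; rewrite /elaw; case: ifP => _ //; rewrite dl pl; ring.
- move=> z; rewrite /elaw; case: ifP => _ //.
  by rewrite addr_ge0 // mulr_ge0 // subr_ge0.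
Qed.

(** A Russo-type formula: each position outside [O] contributes the change of the mean when it
    passes from erased to received. *)
Lemma is_derive_Ex (I : finType) (O : {set I}) F (t : R) :
  is_derive t 1 (fun t => Ex (elaw O t) F)
    (\sum_(i | i \notin O) (Ex (set_law (elaw O t) i p) F - Ex (elaw (i |: O) t) F)).
Proof.
pose dq i z := if i \in O then 0 else p z - pt_mass z.
have dE i z : is_derive t 1 (fun t => elaw O t i z) (dq i z).
  rewrite /elaw /dq; case: ifP => _; first exact: is_derive_cst.
  rewrite (_ : (fun _ => _) = cst (pt_mass z) + ((p z - pt_mass z) \*: id)); last first.
    apply/funext => x.
    by rewrite -[RHS]/(pt_mass z + (p z - pt_mass z) * x); ring.
  apply: is_derive_eq.
  by rewrite add0r -[LHS]/((p z - pt_mass z) * 1) mulr1.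
have dP (y : {ffun I -> T}) := is_derive_bigprod (index_enum_uniq I) (fun i => dE i (y i)).
have dS := is_derive_bigsum (index_enum {ffun I -> T})
  (fun y => is_deriveM (dP y) (is_derive_cst (F y) t 1)).
apply: (is_derive_eq dS).
rewrite /=; under eq_bigr do rewrite scaler0 add0r.
under [RHS]eq_bigr do rewrite -sumrB.
rewrite [RHS]exchange_big /=; apply: eq_bigr => y _.
rewrite -[LHS]/(F y * _) mulr_sumr (bigID (fun i => i \notin O)) /= addrC big1 ?add0r.
  apply: eq_bigr => i iO; rewrite -mulrBl mulrC; congr (_ * _).
  rewrite (bigD1 i) //= eqxx /dq (negPf iO).
  rewrite [X in _ = X - _](bigD1 i) //= [X in _ = _ - X](bigD1 i) //= /set_law eqxx.
  rewrite /elaw setU11 mulrBl; congr (_ * _ - _ * _).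
    by apply: eq_bigr => j /negPf ->.
  by apply: eq_bigr => j /negPf ji; rewrite ji in_setU1 ji.
move=> i; rewrite negbK => iO; rewrite (bigD1 i) //= eqxx /dq iO.
by rewrite mul0r mulr0.
Qed.

Lemma eq_Ex_erased (I : finType) (q : I -> T -> R) i F G : (forall z, z != e -> q i z = 0) ->
  (forall y : {ffun I -> T}, y i = e -> F y = G y) -> Ex q F = Ex q G.
Proof.
move=> hq FG; apply: eq_bigr => y _; case: (eqVneq (y i) e) => [/FG -> //|ye].
by rewrite (bigD1 i) //= hq // !mul0r.
Qed.

Section ErasedCode.
Variables (I : finType) (C : {set {ffun I -> bool}}).
Hypothesis (Clin : linear_code C).

(* [Gam C t] is the mutual information, in nats, between a uniform codeword and
   its output when each symbol is erased with probability [1 - t]; [Delta] and [mu]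
   refer to the bit [o] with its own output erased. *)
Definition Gam (t : R) := ln #|C|%:R - Ex (elaw finset.set0 t) (fun y => ln (Zsum C y)).
Definition Delta (o : I) (t : R) := Ex (elaw [set o] t) (fun y => phi p (pmean C o y)).
Definition mu (o : I) (t : R) := Ex (elaw [set o] t) (pmean C o).

(** The Bayesian update: observing [z] at an erased position multiplies the total likelihood by that
    of [z] under the current posterior of the bit. *)
Lemma Zsum_upd (y : {ffun I -> T}) i z : y i = e -> Zsum C (upd y i z) = Zsum C y * lmix z
  (pmean C i y).
Proof.
move=> ye; have Z0 := Zsum_gt0 Clin y.
transitivity ((Zsum C y + Dsum C i y) / 2 + (Zsum C y - Dsum C i y) / 2 * l z); last first.
  by rewrite /lmix /pmean; field; rewrite lt0r_neq0.
have -> : (Zsum C y + Dsum C i y) / 2 + (Zsum C y - Dsum C i y) / 2 * l z =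
    \sum_(u in C) (wt u y * ((1 + l z) / 2) + (-1) ^+ u i * wt u y * ((1 - l z) / 2)).
  by rewrite big_split /= -!mulr_suml -/(Zsum C y) -/(Dsum C i y); field.
apply: eq_bigr => u _; rewrite /wt (bigD1 i) //= upd_eq.
rewrite [in RHS](bigD1 i) //= ye l_e if_same mul1r.
rewrite (eq_bigr (fun j => if u j then l (y j) else 1)); last first.
  by move=> j /negPf ji; rewrite ffunE ji.
by case: (u i); rewrite ?expr1 ?expr0; field.
Qed.

(** The area theorem. By [Zsum_upd], receiving position [i] adds the logarithm of [lmix] to
    [ln Zsum], and the mean of its negative over [p] is [phi]. *)
Lemma is_derive_Gam (t : R) : is_derive t 1 Gam (\sum_i Delta i t).
Proof.
rewrite (_ : Gam = cst (ln #|C|%:R) - (fun t => Ex (elaw finset.set0 t) (fun y => ln (Zsum C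
  y)))) //.
apply: is_derive_eq; first by apply: is_deriveB; exact: is_derive_Ex.
rewrite sub0r -sumrN; apply: eq_big => i; first by rewrite inE.
move=> _; rewrite finset.setU0 opprB.
(* The law at [i] is overwritten by [p], so it may be declared erased beforehand; both terms then
   live under the same law. *)
have -> : Ex (set_law (elaw finset.set0 t) i p) (fun y => ln (Zsum C y)) =
          Ex (set_law (elaw [set i] t) i p) (fun y => ln (Zsum C y)).
  apply: eq_Ex_law => j z; rewrite /set_law; case: eqP => // /eqP/negPf ji.
  by rewrite /elaw !inE ji.
rewrite Ex_resample ?sum_elaw // -ExB; apply: (@eq_Ex_erased _ _ i).
  by move=> z /negPf ze; rewrite /elaw inE eqxx /pt_mass ze.
move=> y ye; rewrite /phi -[ln (Zsum C y)]mul1r -p1 mulr_suml -sumrB -sumrN.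
apply: eq_bigr => z _; rewrite Zsum_upd // lnM ?posrE ?Zsum_gt0 ?lmix_gt0 ?pmean_le1 //.
ring.
Qed.

Lemma Gam0 : Gam 0 = 0.
Proof.
apply/eqP; rewrite subr_eq0; apply/eqP.
have E (y : {ffun I -> T}) : (forall i, y i = e) -> Zsum C y = #|C|%:R.
  move=> ye; rewrite /Zsum (eq_bigr (fun=> 1)) ?sumr_const // => u _.
  by apply: big1 => i _; rewrite ye l_e if_same.
rewrite -[LHS](@Ex_cst R T I (elaw finset.set0 0)); last by move=> i; exact: sum_elaw.
apply: eq_bigr => y _; case: (boolP [forall i, y i == e]) => [/forallP ye|].
  by rewrite E // => i; apply/eqP.
rewrite negb_forall => /existsP[i /negPf ie].
by rewrite (bigD1 i) //= /elaw inE /pt_mass ie mulr0 !mul0r addr0 !mul0r.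
Qed.

Lemma Gam_le (t : R) : 0 <= t <= 1 -> Gam t <= ln #|C|%:R.
Proof.
move=> ht; rewrite gerBl; apply: Ex_ge0 => [i|y]; first by case: (elaw_sym finset.set0 i ht).
exact/ln_ge0/Zsum_ge1.
Qed.

Section Monotone.
Variables (o i : I) (t : R).
Hypothesis (ht : 0 <= t <= 1).

Let q' := set_law (elaw [set o] t) i p.
Let hq' j : symlaw (q' j).
Proof. by rewrite /q' /set_law; case: ifP => _ //; exact: elaw_sym. Qed.
Let f := pmean C o.
Let g y := f (upd y i e).

Let q'1 j : \sum_z q' j z = 1. Proof. by case: (hq' j) => -[]. Qed.
Let q'p j : prob (q' j). Proof. by case: (hq' j). Qed.

Lemma Ex_erase F : Ex (elaw (i |: [set o]) t) F = Ex q' (fun y => F (upd y i e)).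
Proof.
transitivity (Ex (set_law q' i pt_mass) F).
  apply: eq_Ex_law => j z; rewrite /q' /set_law /elaw in_setU1.
  by case: eqP.
rewrite Ex_resample //; apply: eq_Ex => y.
by rewrite (sum_pt_mass (fun z => F (upd y i z))).
Qed.

Lemma erase_equivariant : equivariant C o g.
Proof.
move=> v y vC; rewrite /g /f -(pmean_equivariant Clin o _ vC); congr pmean.
by apply/ffunP => j; rewrite !ffunE; case: eqP => // _; rewrite se if_same.
Qed.

(** Data processing: [phi_sep] compares [f] with the estimate [g] that ignores position [i]. *)
Lemma Delta_step : Ex q' (fun y => phi p (f y)) <=
  Ex (elaw (i |: [set o]) t) (fun y => phi p (f y)).
Proof.
rewrite Ex_erase -subr_ge0.
apply: le_trans (phi_sep Clin hq' hp erase_equivariant (fun y => pmean_le1 Clin o _)).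
rewrite mulr_ge0 //; last by apply: Ex_ge0 => // y; exact: sqr_ge0.
apply: sumr_ge0 => z _; have [p0 _] := pp; have lz := l_gt0 z.
by rewrite mulr_ge0 // divr_ge0 ?sqr_ge0 // mulr_ge0 // addr_ge0 // ltW.
Qed.

(** Since [E f^2 = E f] and [E (f g) = E g = E g^2], the nonnegative mean of [(f - g)^2] equals
    [E f - E g]. *)
Lemma mu_step : Ex (elaw (i |: [set o]) t) f <= Ex q' f.
Proof.
rewrite Ex_erase -/g.
have E1 := Ex_pmean_mul Clin hq' erase_equivariant.
have E2 := Ex_pmean_sqr Clin hq' o.
have E3 : Ex q' (fun y => g y ^+ 2) = Ex q' g.
  rewrite -(Ex_erase (fun y => f y ^+ 2)) -(Ex_erase f).
  by apply: Ex_pmean_sqr => // j; exact: elaw_sym.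
have : 0 <= Ex q' (fun y => (f y - g y) ^+ 2) by apply: Ex_ge0 => // y; exact: sqr_ge0.
have -> : Ex q' (fun y => (f y - g y) ^+ 2) =
    Ex q' (fun y => f y ^+ 2) - 2 * Ex q' (fun y => f y * g y) + Ex q' (fun y => g y ^+ 2).
  by rewrite -ExZ -ExB -ExD; apply: eq_Ex => y; ring.
by rewrite E1 E2 E3; lra.
Qed.

End Monotone.

Lemma Delta_nonincreasing o (a b : R) : 0 <= a -> a <= b -> b <= 1 -> Delta o b <= Delta o a.
Proof.
move=> a0; rewrite le_eqVlt => /orP[/eqP -> //|ab] b1.
have [c [ac cb E]] := mean_value ab (fun x => is_derive_Ex [set o] (fun y => phi p (pmean C o
  y)) x).
rewrite -subr_le0 E; apply: mulr_le0_ge0; last by rewrite subr_ge0 ltW.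
apply: sumr_le0 => i _; rewrite subr_le0; apply: Delta_step.
by rewrite (le_trans a0 (ltW ac)) (le_trans (ltW cb) b1).
Qed.

Lemma mu_nondecreasing o (a b : R) : 0 <= a -> a <= b -> b <= 1 -> mu o a <= mu o b.
Proof.
move=> a0; rewrite le_eqVlt => /orP[/eqP -> //|ab] b1.
have [c [ac cb E]] := mean_value ab (fun x => is_derive_Ex [set o] (pmean C o) x).
rewrite -subr_ge0 E; apply: mulr_ge0; last by rewrite subr_ge0 ltW.
apply: sumr_ge0 => i _; rewrite subr_ge0; apply: mu_step.
by rewrite (le_trans a0 (ltW ac)) (le_trans (ltW cb) b1).
Qed.

Section Automorphism.
Variable h : I -> I.
Hypothesis (hI : injective h).
Hypothesis (hC : forall u, u \in C -> comp_ffun u h \in C).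

Lemma reindex_auto (F : {ffun I -> bool} -> R) :
  \sum_(u in C) F (comp_ffun u h) = \sum_(u in C) F u.
Proof.
have cI : injective (fun u : {ffun I -> bool} => comp_ffun u h).
  move=> y y' /ffunP yy; apply/ffunP => i.
  by have := yy (invF hI i); rewrite !ffunE f_invF.
(* An injection of the finite set [C] into itself is onto. *)
have E : [set comp_ffun u h | u in C] = C.
  apply/eqP; rewrite eqEcard card_imset // leqnn andbT.
  by apply/fintype.subsetP => _ /imsetP[u uC ->]; exact: hC.
by rewrite -[in RHS]E big_imset //= => u v _ _; exact: cI.
Qed.

Lemma wt_comp u y : wt u y = wt (comp_ffun u h) (comp_ffun y h).
Proof. by rewrite /wt (reindex_inj hI); apply: eq_bigr => i _; rewrite !ffunE. Qed.

Lemma pmean_auto o y : pmean C (h o) y = pmean C o (comp_ffun y h).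
Proof.
congr (_ / _).
  rewrite /Dsum -[RHS]reindex_auto; apply: eq_bigr => u _.
  by rewrite -wt_comp // ffunE.
by rewrite /Zsum -[RHS]reindex_auto; apply: eq_bigr => u _; rewrite -wt_comp.
Qed.

Lemma elaw_auto o t F : Ex (elaw [set h o] t) (fun y => F (comp_ffun y h)) = Ex (elaw [set o]
  t) F.
Proof.
rewrite Ex_reindex //; apply: eq_Ex_law => i z.
by rewrite /elaw !inE (inj_eq hI).
Qed.

Lemma Delta_auto o t : Delta (h o) t = Delta o t.
Proof.
rewrite /Delta -(elaw_auto o t); apply: eq_Ex => y.
by rewrite pmean_auto.
Qed.

Lemma mu_auto o t : mu (h o) t = mu o t.
Proof. by rewrite /mu -(elaw_auto o t); apply: eq_Ex => y; rewrite pmean_auto. Qed.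

End Automorphism.
End ErasedCode.

(** * The Plotkin extension and the sharp threshold *)

Section Plotkin.
Variables (J A : finType) (C C1 : {set {ffun J -> bool}}).
Variables (chi : A -> J -> bool) (o : J).
Hypothesis (Clin : linear_code C).
Hypothesis (C1lin : linear_code C1).
Hypothesis (C1C : C1 \subset C).
Hypothesis (chiC : forall a u, u \in C1 -> [ffun v => chi a v && u v] \in C).
Hypothesis (chi_o : forall a, chi a o = false).
Hypothesis (A_gt0 : (0 < #|A|)%N).
Hypothesis (chi_half : forall v, v != o -> (2 * #|[set a | ~~ chi a v]| <= #|A|)%N).
Hypothesis (trans : forall v, exists h : J -> J, [/\ injective h, h o = v,
  forall u, u \in C -> comp_ffun u h \in C & forall u, u \in C1 -> comp_ffun u h \in C1]).

(** The [(u, u + v)] construction: the half [false] carries [u] and the half [true] carries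
    [u + v]. *)
Definition plotkin (x : {ffun J -> bool} * {ffun J -> bool}) : {ffun J * bool -> bool} :=
  [ffun i => x.1 i.1 (+) (i.2 && x.2 i.1)].

Definition Cplus : {set {ffun J * bool -> bool}} := [set plotkin x | x in finset.setX C C1].

Definition slice (b : J -> bool) (v : J) : J * bool := (v, b v).

Let Cp0 : 0 < #|C|%:R :> R. Proof. exact: cardC_gt0. Qed.
Let C1p0 : 0 < #|C1|%:R :> R. Proof. exact: cardC_gt0. Qed.

Lemma plotkin_inj : injective plotkin.
Proof.
case=> a b [a' b'] /ffunP E.
have Ea : a = a' by apply/ffunP => v; have := E (v, false); rewrite !ffunE /= !addbF.
congr pair => //; apply/ffunP => v.
by have := E (v, true); rewrite !ffunE /= Ea => /addbI.
Qed.

Lemma card_Cplus : #|Cplus| = (#|C| * #|C1|)%N.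
Proof. by rewrite card_imset ?cardsX //; exact: plotkin_inj. Qed.

Lemma Cplus_lin : linear_code Cplus.
Proof.
have [z0 zD] := Clin; have [z1 zD1] := C1lin; split.
  apply/imsetP; exists ([ffun=> false], [ffun=> false]); first by rewrite inE /= z0.
  by apply/ffunP => i; rewrite !ffunE andbF.
move=> _ _ /imsetP[[a b] /setXP[/= aC bC] ->] /imsetP[[a' b'] /setXP[/= aC' bC'] ->].
apply/imsetP; exists (cadd a a', cadd b b'); first by rewrite inE /= zD ?zD1.
by apply/ffunP => -[v []]; rewrite !ffunE //= ?addbF // addbACA.
Qed.

(** Along the graph of [chi a], the word [(x, x + y)] reads [x + chi a * y]. *)
Lemma Cplus_slice a u : u \in Cplus -> comp_ffun u (slice (chi a)) \in C.
Proof.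
move=> /imsetP[[x y] /setXP[/= xC yC] ->]; have [_ zD] := Clin.
rewrite (_ : comp_ffun _ _ = cadd x [ffun v => chi a v && y v]); first by rewrite zD ?chiC.
by apply/ffunP => v; rewrite !ffunE.
Qed.

Lemma Cplus_slice0 u : u \in Cplus -> comp_ffun u (slice xpred0) \in C.
Proof.
move=> /imsetP[[x y] /setXP[/= xC yC] ->].
by rewrite (_ : comp_ffun _ _ = x) //; apply/ffunP => v; rewrite !ffunE addbF.
Qed.

(** A symmetry of [J] is combined with an exchange of the halves. The exchange turns the parameters
    [(x, y)] into [(x + y, y)], which are admissible because [C1] is contained in [C]. *)
Lemma Cplus_trans i : exists h : J * bool -> J * bool,
  [/\ injective h, h (o, false) = i & forall u, u \in Cplus -> comp_ffun u h \in Cplus].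
Proof.
case: i => v b; have [h [hI ho hC hC1]] := trans v; have [_ zD] := Clin; have [z1 _] := C1lin.
exists (fun i => (h i.1, i.2 (+) b)); split.
- by case=> x c [x' c'] [/hI -> /addIb ->].
- by rewrite /= ho.
move=> _ /imsetP[[x y] /setXP[/= xC yC] ->].
apply/imsetP; exists (cadd (comp_ffun x h) (if b then comp_ffun y h else [ffun=> false]),
  comp_ffun y h).
  rewrite inE /= hC1 // andbT zD ?hC //; apply: (fintype.subsetP C1C).
  by case: b => //; exact: hC1.
apply/ffunP => -[w c]; rewrite !ffunE /=; case: b; rewrite !ffunE ?addbF //.
by case: c; case: (x _); case: (y _).
Qed.

Lemma slice_equivariant (b : J -> bool) g : b o = false ->
  (forall u, u \in Cplus -> comp_ffun u (slice b) \in C) -> equivariant C o g ->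
  equivariant Cplus (o, false) (fun y => g (comp_ffun y (slice b))).
Proof.
move=> bo hb hg v y vC.
rewrite (_ : comp_ffun (flip v y) (slice b) = flip (comp_ffun v (slice b)) (comp_ffun y (slice
  b))).
  by rewrite hg ?hb // ffunE /slice bo.
by apply/ffunP => i; rewrite !ffunE.
Qed.

Section AtTime.
Variable t : R.
Hypothesis (ht : 0 <= t <= 1).

Let q := elaw [set o] t.
Let Q := elaw [set (o, false)] t.
Let q1 i : \sum_z q i z = 1. Proof. exact: sum_elaw. Qed.
Let qs i : symlaw (q i). Proof. exact: elaw_sym. Qed.
Let qp i : prob (q i). Proof. by case: (qs i). Qed.
Let Qs i : symlaw (Q i). Proof. exact: elaw_sym. Qed.
Let Qp i : prob (Q i). Proof. by case: (Qs i). Qed.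

Definition Vset (a : A) : {set J} := [set v | ~~ chi a v].

Lemma Ex_pair P : Ex Q (fun y => P (comp_ffun y (slice xpred0)) (comp_ffun y (slice xpredT))) =
  Ex q (fun y0 => Ex (elaw finset.set0 t) (P y0)).
Proof.
rewrite (Ex_prod_bool Q P).
rewrite (@eq_Ex_law _ _ _ _ q); last first.
  by move=> v z; rewrite /Q /q /elaw !inE xpair_eqE eqxx andbT.
apply: eq_Ex => y0; apply: eq_Ex_law => v z.
by rewrite /Q /elaw !inE xpair_eqE andbF.
Qed.

(** The laws differ only at [o]; as [chi a o = false], the mixture takes that coordinate from
    [y0]. *)
Lemma Ex_mix_law (G : {ffun J -> T} -> R) (y0 : {ffun J -> T}) a :
  Ex (elaw finset.set0 t) (fun y => G (mix (Vset a) y0 y)) = Ex q (fun y => G (mix (Vset a) y0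
    y)).
Proof.
have [[_ d1] _] := pt_mass_sym.
rewrite -(@Ex_law_irrel _ _ _ (elaw finset.set0 t) o pt_mass) ?sum_elaw //.
  apply: eq_Ex_law => v z; rewrite /q /set_law /elaw !inE.
  by case: eqP.
by move=> y z; rewrite mix_updr inE chi_o.
Qed.

Lemma slice_mix a (y : {ffun J * bool -> T}) : comp_ffun y (slice (chi a)) =
  mix (Vset a) (comp_ffun y (slice xpred0)) (comp_ffun y (slice xpredT)).
Proof. by apply/ffunP => v; rewrite !ffunE inE /slice; case: (chi a v). Qed.

Lemma Ex_slice a F : Ex Q (fun y => F (comp_ffun y (slice (chi a)))) = Ex q F.
Proof.
under eq_Ex do rewrite slice_mix.
rewrite (Ex_pair (fun y0 y1 => F (mix (Vset a) y0 y1))).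
under eq_Ex do rewrite Ex_mix_law.
exact: Ex_mix.
Qed.

Lemma Ex_slice0 F : Ex Q (fun y => F (comp_ffun y (slice xpred0))) = Ex q F.
Proof.
rewrite (Ex_pair (fun y0 _ => F y0)); apply: eq_Ex => y0; apply: Ex_cst => i.
exact: sum_elaw.
Qed.

Lemma Ex_slice_mul a F :
  Ex Q (fun y => F (comp_ffun y (slice xpred0)) * F (comp_ffun y (slice (chi a)))) =
  stab q (Vset a) F F.
Proof.
under eq_Ex do rewrite slice_mix.
rewrite (Ex_pair (fun y0 y1 => F y0 * F (mix (Vset a) y0 y1))); apply: eq_Ex => y0.
exact: (Ex_mix_law (fun y => F y0 * F y)).
Qed.

(** Under [q] the symbol at [o] is [e] anyway; overwriting it makes [f] independent of coordinate
    [o] at every point, as [avg_stab_le] asks. *)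
Let f y := pmean C o (upd y o e).

Lemma Ex_f (k : R -> R) : Ex q (fun y => k (f y)) = Ex q (fun y => k (pmean C o y)).
Proof.
apply: (@eq_Ex_erased _ _ o) => [z /negPf ze|y ye].
  by rewrite /q /elaw inE eqxx /pt_mass ze.
by rewrite /f -{1}ye upd_same.
Qed.

Let f_eqv : equivariant C o f. Proof. exact: erase_equivariant. Qed.
Let f_le1 y : `|f y| <= 1. Proof. exact: pmean_le1. Qed.

Let kap := Delta C o t - Delta Cplus (o, false) t.

(** The estimate on one slice is an equivariant competitor of the posterior mean in [Cplus], and its
    excess in [phi_sep] is exactly [kap]. *)
Lemma sep_slice (b : J -> bool) : b o = false ->
  (forall u, u \in Cplus -> comp_ffun u (slice b) \in C) ->
  (forall F, Ex Q (fun y => F (comp_ffun y (slice b))) = Ex q F) ->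
  sep p * Ex Q (fun y => (pmean Cplus (o, false) y - f (comp_ffun y (slice b))) ^+ 2) <= kap.
Proof.
move=> bo hb hE.
have := phi_sep Cplus_lin Qs hp (slice_equivariant bo hb f_eqv) (fun y => f_le1 _).
by rewrite (hE (fun y => phi p (f y))) Ex_f.
Qed.

Lemma sep_ge0 : 0 <= sep p.
Proof.
apply: sumr_ge0 => z _; have [p0 _] := pp; have lz := l_gt0 z.
by rewrite mulr_ge0 // divr_ge0 ?sqr_ge0 // mulr_ge0 // addr_ge0 // ltW.
Qed.

Lemma Delta_Cplus_le : 0 <= kap.
Proof.
have := sep_slice (b := xpred0) erefl Cplus_slice0 Ex_slice0.
apply: le_trans; apply: mulr_ge0; first exact: sep_ge0.
by apply: Ex_ge0 => // y; exact: sqr_ge0.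
Qed.

(** The estimates of two slices are both close to that of [Cplus], hence to each other, so [stab] is
    close to the second moment [mu]. On average over [a] it is at most [(mu + mu^2) / 2], which
    leaves [2 mu - (mu + mu^2) = mu (1 - mu)]. *)
Lemma mu_variance : sep p * (mu C o t * (1 - mu C o t)) <= 4 * kap.
Proof.
have fm : Ex q f = mu C o t by rewrite (Ex_f id).
have fm2 : Ex q (fun y => f y ^+ 2) = mu C o t.
  by rewrite (Ex_f (fun x => x ^+ 2)) Ex_pmean_sqr.
have step a : sep p * (2 * mu C o t - 2 * stab q (Vset a) f f) <= 4 * kap.
  have E : 2 * mu C o t - 2 * stab q (Vset a) f f =
      Ex Q (fun y => (f (comp_ffun y (slice xpred0)) - f (comp_ffun y (slice (chi a)))) ^+ 2).
    transitivity (Ex Q (fun y => f (comp_ffun y (slice xpred0)) ^+ 2) +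
        Ex Q (fun y => f (comp_ffun y (slice (chi a))) ^+ 2) -
        2 * Ex Q (fun y => f (comp_ffun y (slice xpred0)) * f (comp_ffun y (slice (chi a))))).
      rewrite (Ex_slice0 (fun y => f y ^+ 2)) (Ex_slice a (fun y => f y ^+ 2)) fm2.
      by rewrite Ex_slice_mul; ring.
    by rewrite -ExZ -ExD -ExB; apply: eq_Ex => y; ring.
  rewrite E.
  have h0 := sep_slice (b := xpred0) erefl Cplus_slice0 Ex_slice0.
  have h1 := sep_slice (chi_o a) (@Cplus_slice a) (Ex_slice a).
  set X := Ex Q _ in h0; set Y := Ex Q _ in h1.
  have : Ex Q (fun y => (f (comp_ffun y (slice xpred0)) - f (comp_ffun y (slice (chi a)))) ^+ 2)
     <= 2 * (X + Y).
    rewrite /X /Y -ExD -ExZ; apply: ler_Ex => // y.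
    set x := pmean _ _ _; set x0 := f _; set x1 := f _.
    by have := sqr_ge0 (x - x0 + (x - x1)); nra.
  move=> /(ler_wpM2l sep_ge0) H; apply: le_trans H _; lra.
have A0 : 0 < #|A|%:R :> R by rewrite ltr0n.
have ES : #|A|%:R^-1 * \sum_a stab q (Vset a) f f <=
    mu C o t ^+ 2 + 2^-1 * (mu C o t - mu C o t ^+ 2).
  rewrite -{2}fm2 -fm.
  apply: (@avg_stab_le _ _ _ _ q Vset 2^-1 qp _ (~: [set o])) => //.
    (* A position other than [o] is shared with the base slice by at most half of the slices, which
       is the factor [1/2] above. *)
    move=> v; rewrite !inE => vo; rewrite mulrC ler_pdivlMr // -natrM ler_nat mulnC.
    apply: leq_trans (chi_half vo); rewrite leq_mul2l /=.
    by apply: subset_leq_card; apply/fintype.subsetP => a; rewrite !inE.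
  by move=> v y z; rewrite !inE negbK => /eqP ->; rewrite /f upd_upd.
have : #|A|%:R^-1 * \sum_(a : A) (sep p * (2 * mu C o t - 2 * stab q (Vset a) f f)) <= 4 * kap.
  rewrite mulrC ler_pdivrMr //; apply: le_trans (ler_sum _ (fun a _ => step a)) _.
  by rewrite sumr_const mulr_natr.
rewrite -mulr_sumr sumrB sumr_const -mulr_sumr -[_ *+ #|_|]mulr_natr.
set S := \sum_a _ in ES *.
have -> : #|A|%:R^-1 * (sep p * (2 * mu C o t * #|A|%:R - 2 * S)) =
    sep p * (2 * mu C o t - 2 * (#|A|%:R^-1 * S)) by field; rewrite lt0r_neq0.
apply: le_trans; apply: ler_wpM2l; first exact: sep_ge0.
lra.
Qed.

End AtTime.

(** The pairs [(u, u + v)] with [v] in [C1] are some of the pairs of [C * C] over which the product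
    on the right expands. *)
Lemma Zsum_plus (y : {ffun J * bool -> T}) :
  Zsum Cplus y <= Zsum C (comp_ffun y (slice xpred0)) * Zsum C (comp_ffun y (slice xpredT)).
Proof.
rewrite /Zsum /Cplus big_imset /=; last by move=> x x' _ _; exact: plotkin_inj.
set y0 := comp_ffun y _; set y1 := comp_ffun y _.
have wE x : wt (plotkin x) y = wt x.1 y0 * wt (cadd x.1 x.2) y1.
  rewrite /wt -big_split /=.
  rewrite (eq_bigr (fun i : J * bool => (fun v b => if plotkin x (v, b) then l (y (v, b)) else
    1) i.1 i.2)); last by case.
  rewrite -(pair_bigA _ (fun v b => if plotkin x (v, b) then l (y (v, b)) else 1)) /=.
  by apply: eq_bigr => v _; rewrite big_bool !ffunE /= addbF mulrC.
under eq_bigr do rewrite wE.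
rewrite (eq_bigl (fun x => (x.1 \in C) && (x.2 \in C1))); last by case=> u v; rewrite
  finset.in_setX.
rewrite -(pair_big (mem C) (mem C1) (fun u v => wt u y0 * wt (cadd u v) y1)) /= mulr_suml;
  apply: ler_sum => u uC; rewrite -mulr_sumr.
apply: ler_wpM2l; first exact/ltW/wt_gt0.
rewrite [leRHS](reindex_cadd Clin _ uC).
rewrite [leRHS](bigID (mem C1)) /=; rewrite -[leLHS]addr0; apply: lerD.
  rewrite [leRHS](eq_bigl (mem C1)); last first.
    by move=> v /=; apply: andb_idl => /(fintype.subsetP C1C).
  rewrite le_eqVlt; apply/orP; left; apply/eqP; apply: eq_bigr => v _.
  by congr wt; apply/ffunP => i; rewrite !ffunE addbC.
by apply: sumr_ge0 => v _; exact/ltW/wt_gt0.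
Qed.

Lemma Gam_plus : 2 * Gam C 1 - Gam Cplus 1 <= ln #|C|%:R - ln #|C1|%:R.
Proof.
have t1 : 0 <= (1 : R) <= 1 by rewrite ler01 lexx.
have : Ex (elaw finset.set0 1) (fun y => ln (Zsum Cplus y)) <=
    2 * Ex (elaw finset.set0 1) (fun y => ln (Zsum C y)).
  apply: (@le_trans _ _ (Ex (elaw finset.set0 1) (fun y =>
    ln (Zsum C (comp_ffun y (slice xpred0))) + ln (Zsum C (comp_ffun y (slice xpredT)))))).
    apply: ler_Ex => [i|y]; first by case: (elaw_sym finset.set0 i t1).
    rewrite -lnM ?posrE ?Zsum_gt0 // ler_ln ?posrE ?mulr_gt0 ?Zsum_gt0 //; last exact: Cplus_lin.
    exact: Zsum_plus.
  rewrite (Ex_prod_bool _ (fun y0 y1 => ln (Zsum C y0) + ln (Zsum C y1))).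
  have eE (b : bool) : (fun v : J => elaw finset.set0 1 (v, b)) =2 elaw finset.set0 1.
    by move=> v z; rewrite /elaw !inE.
  rewrite (eq_Ex_law _ (eE false)).
  under eq_Ex do rewrite (eq_Ex_law _ (eE true)) ExD (@Ex_cst _ _ _ _ _ (@sum_elaw _
    finset.set0 1)).
  rewrite ExD (@Ex_cst _ _ _ _ _ (@sum_elaw _ finset.set0 1)); lra.
rewrite /Gam card_Cplus natrM lnM ?posrE //; lra.
Qed.

Lemma mu_threshold (eta theta : R) : 0 < eta -> eta < 1 -> 0 < theta ->
  ln #|C|%:R < #|J|%:R * ((1 - eta) * (phi p 0 - theta)) ->
  sep p * (eta * theta * #|J|%:R) * (1 - mu C o 1) <= 2 * (ln #|C|%:R - ln #|C1|%:R).
Proof.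
move=> eta0 eta1 th0 hR.
have N0 : 0 < #|J|%:R :> R by rewrite ltr0n; apply/card_gt0P; exists o.
have dC t : \sum_i Delta C i t = #|J|%:R * Delta C o t.
  rewrite (eq_bigr (fun=> Delta C o t)) ?sumr_const ?mulr_natl // => v _.
  by have [h [hI <- hC _]] := trans v; rewrite Delta_auto.
have dCp t : \sum_i Delta Cplus i t = 2 * #|J|%:R * Delta Cplus (o, false) t.
  rewrite (eq_bigr (fun=> Delta Cplus (o, false) t)).
    by rewrite sumr_const -[_ *+ #|_|]mulr_natl card_prod card_bool natrM [_ * 2]mulrC.
  by move=> i _; have [h [hI <- hC]] := Cplus_trans i; rewrite Delta_auto.
pose D t := 2 * Gam C t - Gam Cplus t.
pose dD t := 2 * #|J|%:R * (Delta C o t - Delta Cplus (o, false) t).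
have dDE (t : R) : is_derive t 1 D (dD t).
  rewrite (_ : D = (2 \*: Gam C) - Gam Cplus); last first.
    by apply/funext => x; rewrite -[RHS]/(2 * Gam C x - Gam Cplus x).
  have := is_deriveB (is_deriveZ 2 (is_derive_Gam Clin t)) (is_derive_Gam Cplus_lin t).
  move/is_derive_eq; apply; rewrite dC dCp /dD -[_ *: _]/(_ * _); ring.
(* [D] vanishes at 0 and has nonnegative derivative by [Delta_Cplus_le]; with [Gam_plus], its
   increase on the last interval of length [eta] is at most the difference of the logarithmic
   sizes. *)
have D_ge0 : 0 <= D (1 - eta).
  have e0 : 0 < 1 - eta by rewrite subr_gt0.
  have [c [c0 c1 E]] := mean_value e0 dDE.
  have -> : D (1 - eta) = dD c * (1 - eta - 0).
    by rewrite -E /D !Gam0 // mulr0 !subr0.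
  rewrite subr0 mulr_ge0 ?(ltW e0) // /dD mulr_ge0 ?mulr_ge0 // ?(ltW N0) //.
  by apply: Delta_Cplus_le; rewrite (ltW c0) (le_trans (ltW c1)) // gerBl ltW.
have e1 : 1 - eta < 1 by rewrite gtrBl.
have [t [t0 t1 E]] := mean_value e1 dDE.
have t00 : 0 < t by apply: lt_trans t0; rewrite subr_gt0.
have ht : 0 <= t <= 1 by rewrite !ltW.
have kapE : 2 * #|J|%:R * eta * (Delta C o t - Delta Cplus (o, false) t) <=
    ln #|C|%:R - ln #|C1|%:R.
  apply: le_trans Gam_plus; rewrite -/(D 1).
  have -> : 2 * #|J|%:R * eta * (Delta C o t - Delta Cplus (o, false) t) = D 1 - D (1 - eta).
    by rewrite E /dD; ring.
  by rewrite gerBl.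
have lnC0 : 0 <= ln #|C|%:R :> R.
  by apply: ln_ge0; rewrite ler1n; move: Cp0; rewrite ltr0n.
(* Otherwise [Delta] would be at least [phi 0 - theta] at [t], hence on all of [[0, t]], and the
   area below it would exceed [ln #|C|]. *)
have muth : theta < mu C o t.
  rewrite ltNge; apply/negP => muth.
  have Dge := Ex_phi_ge Clin (fun i => elaw_sym [set o] i ht) hp o.
  rewrite -/(mu C o t) -/(Delta C o t) in Dge.
  have [c [c0 c1 Ec]] := mean_value t00 (fun x => is_derive_Gam Clin x).
  rewrite Gam0 // !subr0 dC in Ec.
  have Dc : Delta C o t <= Delta C o c by apply: Delta_nonincreasing => //; exact: ltW.
  have Gt := Gam_le Clin ht.
  have P0 : 0 < phi p 0 - theta.
    have : 0 < #|J|%:R * ((1 - eta) * (phi p 0 - theta)) by exact: le_lt_trans hR.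
    by rewrite pmulr_rgt0 // pmulr_rgt0 // subr_gt0.
  have H1 : phi p 0 - theta <= Delta C o c by lra.
  have : #|J|%:R * ((1 - eta) * (phi p 0 - theta)) <= #|J|%:R * Delta C o c * t.
    rewrite -mulrA ler_wpM2l ?(ltW N0) // mulrC ler_pM ?(ltW P0) //.
      by rewrite subr_ge0 ltW.
    exact: ltW.
  rewrite -Ec => H2; have := lt_le_trans hR (le_trans H2 Gt).
  by rewrite ltxx.
have V := mu_variance ht.
(* Going from [t] to 1 only decreases [1 - mu], while the other factor of [mu (1 - mu)] at [t] is at
   least [theta]. *)
have m1 : mu C o t <= mu C o 1 by apply: mu_nondecreasing => //; exact: ltW.
have mle1 : mu C o 1 <= 1.
  have t11 : 0 <= (1 : R) <= 1 by rewrite ler01 lexx.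
  rewrite -[leRHS](@Ex_cst _ _ _ (elaw [set o] 1)); last exact: sum_elaw.
  apply: ler_Ex => [i|y]; first by case: (elaw_sym [set o] i t11).
  by have := pmean_le1 Clin o y; rewrite ler_norml => /andP[].
apply: (@le_trans _ _ (4 * #|J|%:R * eta * (Delta C o t - Delta Cplus (o, false) t))); last first.
  by apply: le_trans (ler_wpM2l _ kapE); [rewrite le_eqVlt; apply/orP; left; apply/eqP; ring | ].
have -> : sep p * (eta * theta * #|J|%:R) * (1 - mu C o 1) =
  eta * #|J|%:R * (sep p * (theta * (1 - mu C o 1))) by ring.
have -> : 4 * #|J|%:R * eta * (Delta C o t - Delta Cplus (o, false) t) =
  eta * #|J|%:R * (4 * (Delta C o t - Delta Cplus (o, false) t)) by ring.
apply: ler_wpM2l; first by rewrite mulr_ge0 // ltW.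
apply: le_trans V; apply: ler_wpM2l; first exact: sep_ge0.
by apply: ler_pM; rewrite ?subr_ge0 ?lerD2l ?lerN2 // ltW.
Qed.

End Plotkin.
End Erasure.
End SymmetricChannel.

(** * Reed-Muller codes *)

Section ReedMuller.
Variable m : nat.
Local Notation N := (2 ^ m)%N.

Definition bits (k : 'I_N) : {ffun 'I_m -> bool} := [ffun j : 'I_m => bit k j].

Lemma bit_eq n k k' : (k < 2 ^ n)%N -> (k' < 2 ^ n)%N ->
  (forall j, (j < n)%N -> bit k j = bit k' j) -> k = k'.
Proof.
elim: n k k' => [|n IH] k k'; first by rewrite expn0 !ltnS !leqn0 => /eqP -> /eqP ->.
rewrite expnS => hk hk' hb.
have h0 : odd k = odd k' by have := hb 0%N isT; rewrite /bit expn0 !divn1.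
rewrite -(odd_double_half k) -(odd_double_half k') h0; congr (_ + _.*2)%N.
apply: IH; rewrite -?divn2 ?ltn_divLR // 1?mulnC // => j jn.
by have := hb j.+1 jn; rewrite /bit -!divnMA -expnS.
Qed.

Lemma bits_inj : injective bits.
Proof.
move=> k k' /ffunP E; apply/val_inj/(bit_eq (ltn_ord k) (ltn_ord k')) => j jm.
by have := E (Ordinal jm); rewrite !ffunE.
Qed.

Lemma bits_bij : bijective bits.
Proof. by apply: inj_card_bij bits_inj _; rewrite card_ffun card_bool !card_ord. Qed.

Definition mono (S : {set 'I_m}) : {ffun 'I_N -> bool} :=
  [ffun k : 'I_N => [forall j in S, bit k j]].

Definition ev (c : {set {set 'I_m}}) : {ffun 'I_N -> bool} :=
  [ffun k => \big[addb/false]_(S in c) mono S k].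

Definition low (d : nat) : {set {set {set 'I_m}}} := powerset [set S : {set 'I_m} | #|S| < d]%N.

(* The Reed-Muller code with the strict degree bound [d]: this allows the zero code, [d = 0]. *)
Definition RMlt (d : nat) : {set {ffun 'I_N -> bool}} := ev @: low d.

Lemma RM_RMlt r : RM r m = RMlt r.+1.
Proof.
apply/setP => u; rewrite inE; apply/existsP/imsetP.
  case=> c /andP[/forallP hc /forallP hu]; exists [set S | c S].
    rewrite inE; apply/fintype.subsetP => S; rewrite !inE ltnS => cS.
    by have := hc S; rewrite cS implybF -leqNgt.
  apply/ffunP => k; rewrite (eqP (hu k)) ffunE [RHS]big_mkcond /=.
  by apply: eq_bigr => S _; rewrite inE ffunE; case: (c S).
case=> c; rewrite inE => /fintype.subsetP hc ->; exists [ffun S => S \in c].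
apply/andP; split; apply/forallP.
  move=> S; apply/implyP => rS; rewrite ffunE; apply/negP => /hc.
  by rewrite inE ltnS leqNgt rS.
move=> k; apply/eqP; rewrite ffunE [LHS]big_mkcond /=.
by apply: eq_bigr => S _; rewrite !ffunE; case: (S \in c).
Qed.

Lemma ev_add c c' : ev ((c :\: c') :|: (c' :\: c)) = cadd (ev c) (ev c').
Proof.
apply/ffunP => k; rewrite !ffunE big_mkcond [X in _ = X (+) _]big_mkcond.
rewrite [X in _ = _ (+) X]big_mkcond -big_split /=; apply: eq_bigr => S _.
by rewrite !inE; case: (S \in c); case: (S \in c'); rewrite /= ?addbF // addbb.
Qed.

Lemma ev0 : ev finset.set0 = [ffun=> false].
Proof. by apply/ffunP => k; rewrite !ffunE big1 // => S; rewrite inE. Qed.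

Lemma RMlt_lin d : linear_code (RMlt d).
Proof.
split.
  by apply/imsetP; exists finset.set0; rewrite ?ev0 // inE finset.sub0set.
move=> _ _ /imsetP[c + ->] /imsetP[c' + ->]; rewrite !inE => hc hc'.
apply/imsetP; exists ((c :\: c') :|: (c' :\: c)); last by rewrite ev_add.
rewrite inE finset.subUset !(fintype.subset_trans (finset.subsetDl _ _)) //.
Qed.

Lemma RMlt_sub d d' : (d <= d')%N -> RMlt d \subset RMlt d'.
Proof.
move=> dd; apply: imsetS; apply/fintype.subsetP => c; rewrite !inE => /fintype.subset_trans;
  apply.
by apply/fintype.subsetP => S; rewrite !inE => /leq_trans; apply.
Qed.

Lemma mono_RMlt (S : {set 'I_m}) d : (#|S| < d)%N -> mono S \in RMlt d.
Proof.
move=> Sd; apply/imsetP; exists [set S].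
  by rewrite inE; apply/fintype.subsetP => S'; rewrite !inE => /eqP ->.
by apply/ffunP => k; rewrite [RHS]ffunE big_set1.
Qed.

Lemma RMlt_ind (P : {ffun 'I_N -> bool} -> Prop) d :
  P [ffun=> false] -> (forall u v, P u -> P v -> P (cadd u v)) ->
  (forall S : {set 'I_m}, (#|S| < d)%N -> P (mono S)) -> forall u, u \in RMlt d -> P u.
Proof.
move=> P0 PD PS _ /imsetP[c + ->]; rewrite inE => /fintype.subsetP hc.
have -> : ev c = \big[@cadd 'I_N/[ffun=> false]]_(S in c) mono S.
  apply/ffunP => k; rewrite ffunE.
  rewrite (big_morph (fun u : {ffun 'I_N -> bool} => u k) (id1 := false) (op1 := addb)) //.
    by move=> u v; rewrite ffunE.
  by rewrite ffunE.
apply: (big_ind P) => // S /hc; rewrite inE; exact: PS.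
Qed.

Lemma RMlt_mul_affine d j b u : u \in RMlt d ->
  [ffun k : 'I_N => (bit k (j : 'I_m) (+) b) && u k] \in RMlt d.+1.
Proof.
have [z0 zD] := RMlt_lin d.+1.
move: u; apply: RMlt_ind.
- by rewrite (_ : [ffun k => _] = [ffun=> false]) //; apply/ffunP => k; rewrite !ffunE andbF.
- move=> u v hu hv; rewrite (_ : [ffun k => _] =
    cadd [ffun k : 'I_N => (bit k j (+) b) && u k] [ffun k : 'I_N => (bit k j (+) b) && v k])
      ?zD //.
  by apply/ffunP => k; rewrite !ffunE andb_addr.
move=> S Sd.
have -> : [ffun k : 'I_N => (bit k j (+) b) && mono S k] =
    cadd (mono (j |: S)) (if b then mono S else [ffun=> false]).
  apply/ffunP => k; rewrite !ffunE.
  have -> : [forall i in j |: S, bit k i] = bit k j && [forall i in S, bit k i].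
    apply/forall_inP/andP => [h|[h1 /forall_inP h2] i].
      by split; [apply: h; rewrite setU11 | apply/forall_inP => i iS; apply: h; rewrite
        in_setU1 iS orbT].
    by rewrite in_setU1 => /orP[/eqP -> //|]; exact: h2.
  by case: b; rewrite !ffunE; case: (bit k j); case: [forall i in S, bit k i].
apply: zD; first by apply: mono_RMlt; rewrite cardsU1; case: (j \notin S) => //=; rewrite ltnS
  ltnW.
by case: b => //; apply: mono_RMlt; exact: ltnW.
Qed.

Lemma RMlt_prod_affine (b : 'I_m -> bool) (s : seq 'I_m) :
  [ffun k : 'I_N => all (fun j : 'I_m => bit k j (+) b j) s] \in RMlt (size s).+1.
Proof.
elim: s => [|j s IH] /=.
  rewrite (_ : [ffun k => _] = mono finset.set0); first by apply: mono_RMlt; rewrite cards0.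
  by apply/ffunP => k; rewrite !ffunE; apply/esym/forall_inP => j; rewrite inE.
rewrite (_ : [ffun k => _] = [ffun k : 'I_N => (bit k j (+) b j) &&
    [ffun k : 'I_N => all (fun j : 'I_m => bit k j (+) b j) s] k]); first exact: RMlt_mul_affine.
by apply/ffunP => k; rewrite !ffunE.
Qed.

(** [h] adds the digits of [v]; it turns a monomial into a product of as many affine forms. *)
Lemma RMlt_translation (v : 'I_N) : exists h : 'I_N -> 'I_N,
  [/\ injective h, (forall k : 'I_N, k = 0%N :> nat -> h k = v) &
      forall d u, u \in RMlt d -> comp_ffun u h \in RMlt d].
Proof.
have [g bK gK] := bits_bij; pose h k := g (cadd (bits k) (bits v)).
have hb k (j : 'I_m) : bit (h k) j = bit k j (+) bit v j.
  have /ffunP/(_ j) : bits (h k) = cadd (bits k) (bits v) by rewrite gK.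
  by rewrite !ffunE.
exists h; split.
- move=> k k' hk; apply: bits_inj; apply/ffunP => j; rewrite !ffunE.
  by apply: (@addIb (bit v j)); rewrite -!hb hk.
- move=> k k0; apply: bits_inj; apply/ffunP => j; rewrite !ffunE hb k0.
  by rewrite /bit div0n.
move=> d; have [z0 zD] := RMlt_lin d; apply: RMlt_ind.
- by rewrite (_ : comp_ffun _ _ = [ffun=> false]) //; apply/ffunP => k; rewrite !ffunE.
- move=> u u' hu hu'; rewrite (_ : comp_ffun _ _ = cadd (comp_ffun u h) (comp_ffun u' h)) ?zD //.
  by apply/ffunP => k; rewrite !ffunE.
move=> S Sd; have := RMlt_prod_affine (fun j => bit v j) (enum S).
rewrite -cardE => /(fintype.subsetP (RMlt_sub Sd)).
rewrite (_ : comp_ffun _ _ = [ffun k : 'I_N => all (fun j : 'I_m => bit k j (+) bit v j) (enum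
  S)]) //.
apply/ffunP => k; rewrite !ffunE; apply/forall_inP/allP => H j.
  by rewrite mem_enum -hb; exact: H.
by rewrite hb => jS; apply: H; rewrite mem_enum.
Qed.

Definition chi (a : {set 'I_m}) (k : 'I_N) : bool := \big[addb/false]_(j in a) bit k j.

Lemma chi_mul d a u : u \in RMlt d -> [ffun k => chi a k && u k] \in RMlt d.+1.
Proof.
move=> ud; have [z0 zD] := RMlt_lin d.+1.
have -> : [ffun k => chi a k && u k] = \big[@cadd 'I_N/[ffun=> false]]_(j in a)
    [ffun k : 'I_N => (bit k j (+) false) && u k].
  apply/ffunP => k; rewrite ffunE /chi.
  rewrite (big_morph (fun u : {ffun 'I_N -> bool} => u k) (id1 := false) (op1 := addb)); last 2
    first.
  - by move=> x y; rewrite ffunE.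
  - by rewrite ffunE.
  rewrite (big_morph (fun b => b && u k) (id1 := false) (op1 := addb)) //.
    by apply: eq_bigr => j _; rewrite ffunE addbF.
  by move=> x y; rewrite andb_addl.
by apply: (big_ind (fun u => u \in RMlt d.+1)) => // j _; exact: RMlt_mul_affine.
Qed.

Lemma chi0 a (k : 'I_N) : k = 0%N :> nat -> chi a k = false.
Proof. by move=> k0; apply: big1 => j _; rewrite k0 /bit div0n. Qed.

(** If digit [j] of [k] is 1, toggling [j] in [a] changes the value of [chi a k]. *)
Lemma chi_half (k : 'I_N) : k != 0%N :> nat -> (2 * #|[set a | ~~ chi a k]| <= #|{set 'I_m}|)%N.
Proof.
move=> k0.
have [j bj] : exists j : 'I_m, bit k j.
  apply/existsP; rewrite -[X in is_true X]negbK negb_exists; apply/negP => /forallP hk.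
  case/eqP: k0; apply: (@bit_eq m) => //; first by rewrite expn_gt0.
  by move=> j jm; rewrite (negPf (hk (Ordinal jm))) /bit div0n.
pose fl (a : {set 'I_m}) := if j \in a then a :\ j else j |: a.
have flK : involutive fl.
  move=> a; rewrite /fl; case: (boolP (j \in a)) => ja.
    by rewrite finset.setD11 finset.setD1K.
  by rewrite finset.setU11 finset.setU1K.
have flC a : chi (fl a) k = ~~ chi a k.
  rewrite /fl /chi; case: (boolP (j \in a)) => ja.
    by rewrite [in RHS](big_setD1 j ja) /= bj addTb negbK.
  by rewrite big_setU1 //= bj addTb.
rewrite mul2n -addnn -[leqRHS]cardsT -(cardsID [set a | ~~ chi a k] [set: {set 'I_m}])
  finset.setTI leq_add2l.
have cX : #|fl @: [set a | ~~ chi a k]| = #|[set a | ~~ chi a k]|.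
  by apply: card_imset; exact: inv_inj.
rewrite -cX; apply: subset_leq_card; apply/fintype.subsetP => _ /imsetP[a + ->].
by rewrite !inE => ca; rewrite flC ca.
Qed.

Lemma ev_inj : injective ev.
Proof.
have main c : ev c = [ffun=> false] -> c = finset.set0.
  move=> /ffunP ec; apply/eqP; apply/negPn/negP => /set0Pn[S0 S0c].
  (* At the indicator of [S] a monomial is 1 only if its set lies in [S]; by minimality [S] itself
     is the only such set in [c]. *)
  case: (arg_minnP (fun S : {set 'I_m} => #|S|) S0c) => S Sc Smin.
  have [g bK gK] := bits_bij.
  have := ec (g [ffun j => j \in S]); rewrite !ffunE (bigD1 S) //= big1.
    rewrite addbF ffunE; set k := g _; have /ffunP hk : bits k = [ffun j => j \in S] by rewrite
      gK.
    move/negbT/negP; apply; apply/forall_inP => j jS.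
    by have := hk j; rewrite !ffunE => ->.
  move=> S' /andP[S'c SS']; rewrite ffunE; set k := g _.
  have /ffunP hk : bits k = [ffun j => j \in S] by rewrite gK.
  apply/negP => /forall_inP h; case/eqP: SS'; apply/eqP; rewrite eqEcard Smin // andbT.
  by apply/fintype.subsetP => j /h; have := hk j; rewrite !ffunE => ->.
move=> c c' E.
have /main/setP D0 : ev ((c :\: c') :|: (c' :\: c)) = [ffun=> false].
  by rewrite ev_add E; apply/ffunP => k; rewrite !ffunE addbb.
apply/setP => S; have := D0 S; rewrite !inE.
by case: (S \in c); case: (S \in c').
Qed.

Lemma card_RMlt d : #|RMlt d| = (2 ^ (\sum_(i < d) 'C(m, i)))%N.
Proof.
rewrite card_imset; last exact: ev_inj.
rewrite card_powerset; congr (_ ^ _)%N; elim: d => [|d IH].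
  by rewrite big_ord0; apply/eqP; rewrite cards_eq0; apply/eqP/setP => S; rewrite !inE.
rewrite big_ord_recr /= -IH -[X in 'C(X, d)]card_ord -card_draws.
rewrite -cardsUI [X in (_ + X)%N](_ : _ = 0)%N ?addn0.
  by congr #|pred_of_set _|; apply/setP => S; rewrite !inE ltnS leq_eqVlt orbC.
apply/eqP; rewrite cards_eq0; apply/eqP/setP => S; rewrite !inE.
by case: ltngtP.
Qed.

End ReedMuller.

(** * Uniform smallness of one binomial coefficient *)

Lemma central_bin n : ('C(n.*2, n) ^ 2 * n.*2.+1 <= 16 ^ n)%N.
Proof.
elim: n => [|n IH]; first by rewrite bin0.
have E : (n.+1 * 'C(n.+1.*2, n.+1) = 2 * n.*2.+1 * 'C(n.*2, n))%N.
  have h1 := mul_bin_diag n.+1.*2 n.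
  have h2 := mul_bin_diag n.*2.+1 n.
  have h3 : 'C(n.*2.+1, n) = 'C(n.*2.+1, n.+1).
    by rewrite -[RHS]bin_sub ?ltnS -?addnn ?leq_addr // subSS addnK.
  rewrite doubleS /= in h1 h2; rewrite doubleS.
  apply/eqP; rewrite -(eqn_pmul2l (ltn0Sn n)) -h1 h3; apply/eqP.
  transitivity (2 * (n.+1 * (n.+1 * 'C(n.*2.+1, n.+1))))%N; first by lia.
  by rewrite -h2; lia.
set x := 'C(_, _) in E *; set c := 'C(_, _) in IH E.
rewrite -(leq_pmul2l (ltn0Sn n)) -(leq_pmul2l (ltn0Sn n)).
have -> : (n.+1 * (n.+1 * (x ^ 2 * n.+1.*2.+1)) = (n.+1 * x) ^ 2 * n.+1.*2.+1)%N by lia.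
rewrite E.
have -> : ((2 * n.*2.+1 * c) ^ 2 * n.+1.*2.+1 = 4 * n.*2.+1 * n.+1.*2.+1 * (c ^ 2 * n.*2.+1))%N
  by lia.
apply: leq_trans (leq_mul (leqnn _) IH) _.
rewrite [(16 ^ n.+1)%N]expnS.
have -> : (n.+1 * (n.+1 * (16 * 16 ^ n)) = (16 * (n.+1 * n.+1)) * 16 ^ n)%N by lia.
by rewrite leq_mul2r; apply/orP; right; lia.
Qed.

(** In Vandermonde's identity ['C(m, r)^2] is one summand of ['C(2m, m)]; this treats all [r] and
    both parities of [m] at once. *)
Lemma bin_pow4_le m r : (r <= m)%N -> ('C(m, r) ^ 4 * m.*2.+1 <= 16 ^ m)%N.
Proof.
move=> rm; apply: leq_trans (central_bin m); rewrite leq_mul2r; apply/orP; right.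
rewrite (expnM _ 2 2) leq_exp2r // -addnn -binomial.Vandermonde.
rewrite (bigD1 (Ordinal (rm : (r < m.+1)%N))) //= bin_sub // mulnn.
exact: leq_addr.
Qed.

Lemma bin_ratio_small (R : realType) (d : R) : 0 < d ->
  exists M, forall m r, (M <= m)%N -> (r <= m)%N -> 'C(m, r)%:R / (2 ^ m)%:R < d.
Proof.
move=> d0; have d4 : 0 < d ^+ 4 by rewrite exprn_gt0.
(* A ratio of at least [d] would force [2m + 1 <= d^-4]. *)
exists (Num.truncn (d ^+ 4)^-1) => m r Mm rm; rewrite ltNge; apply/negP => dle.
have p0 : 0 < (2 ^ m)%:R :> R by rewrite ltr0n expn_gt0.
rewrite ler_pdivlMr // in dle.
have : d ^+ 4 * (2 ^ m)%:R ^+ 4 <= 'C(m, r)%:R ^+ 4.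
  by rewrite -exprMn lerXn2r ?nnegrE // mulr_ge0 // ltW.
have := bin_pow4_le rm; rewrite -(ler_nat R) natrM natrX.
have -> : (16 ^ m = (2 ^ m) ^ 4)%N by rewrite -expnM mulnC expnM.
rewrite [X in _ <= X]natrX => H1 H2.
have m1 : 0 < m.*2.+1%:R :> R by rewrite ltr0n.
have := le_trans (ler_wpM2r (ltW m1) H2) H1.
rewrite mulrAC ger_pMl ?exprn_gt0 // => H3.
have : m.*2.+1%:R <= (d ^+ 4)^-1 by rewrite -[leRHS]mul1r ler_pdivlMr // mulrC.
have i0 : 0 <= (d ^+ 4)^-1 by rewrite invr_ge0 ltW.
have /andP[_ tl] := truncn_itv i0.
rewrite leNgt => /negP; apply; apply: lt_le_trans tl _; rewrite ler_nat ltnS.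
by apply: leq_trans Mm _; rewrite -addnn leq_addr.
Qed.

Section RMThreshold.
Variables (R : realType) (T : finType) (s : T -> T) (l : T -> R) (e : T) (p : T -> R).
Hypothesis (sK : involutive s).
Hypothesis (l_gt0 : forall z, 0 < l z).
Hypothesis (l_s : forall z, l (s z) = (l z)^-1).
Hypothesis (se : s e = e).
Hypothesis (hp : symlaw s l p).

(** [mu_threshold] for two consecutive codes, whose logarithmic sizes differ by ['C(m, r) * ln 2];
    translations carry position [i] to position 0. *)
Lemma RM_threshold r m (i : 'I_(2 ^ m)) (eta theta : R) :
  0 < eta -> eta < 1 -> 0 < theta ->
  rate R r m * ln 2 < (1 - eta) * (phi l p 0 - theta) ->
  sep l p * (eta * theta) * (1 - mu l e p (RM r m) i 1) <=
  2 * ln 2 * ('C(m, r)%:R / (2 ^ m)%:R).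
Proof.
move=> eta0 eta1 th0 hR; rewrite RM_RMlt.
have N0 : (0 < 2 ^ m)%N by rewrite expn_gt0.
have NR : 0 < (2 ^ m)%:R :> R by rewrite ltr0n.
pose o := Ordinal N0.
have [h [hI ho hC]] := RMlt_translation i.
have -> : mu l e p (RMlt m r.+1) i 1 = mu l e p (RMlt m r.+1) o 1.
  by rewrite -(ho o erefl) mu_auto // => u; exact: hC.
have lnRM d : ln #|RMlt m d|%:R = (\sum_(j < d) 'C(m, j))%:R * ln 2 :> R.
  by rewrite card_RMlt natrX lnXn // mulr_natl.
have M := @mu_threshold R T s l sK l_gt0 l_s e p se hp 'I_(2 ^ m) {set 'I_m}
  (RMlt m r.+1) (RMlt m r) (@chi m) o (RMlt_lin _ _) (RMlt_lin _ _) (RMlt_sub m (leqnSn r))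
  (fun a u => @chi_mul m r a u) (fun a => chi0 a (erefl : o = 0%N :> nat)).
have {}M := M _ _ _ _ _ eta0 eta1 th0 _.
rewrite !lnRM card_ord in M.
have {}M : sep l p * (eta * theta * (2 ^ m)%:R) * (1 - mu l e p (RMlt m r.+1) o 1) <=
    2 * ((\sum_(j < r.+1) 'C(m, j))%:R * ln 2 - (\sum_(j < r) 'C(m, j))%:R * ln 2).
  apply: M.
  - by apply/card_gt0P; exists finset.set0.
  - by move=> v vo; apply: chi_half; apply: contraNneq vo => v0; apply/eqP/val_inj.
  - move=> v; have [h' [hI' ho' hC']] := RMlt_translation v.
    by exists h'; split=> //; [exact: ho' | move=> u; exact: hC' | move=> u; exact: hC'].
  - have : (2 ^ m)%:R * (rate R r m * ln 2) < (2 ^ m)%:R * ((1 - eta) * (phi l p 0 - theta)).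
      by rewrite ltr_pM2l.
    by rewrite /rate mulrA [_ * (_ / _)]mulrCA mulfV ?lt0r_neq0 // mulr1.
have dE : (\sum_(j < r.+1) 'C(m, j))%:R * ln 2 - (\sum_(j < r) 'C(m, j))%:R * ln 2 =
    'C(m, r)%:R * ln 2 :> R by rewrite big_ord_recr /= natrD; ring.
rewrite dE in M.
rewrite [leRHS](_ : _ = 2 * ('C(m, r)%:R * ln 2) / (2 ^ m)%:R); last by field; rewrite lt0r_neq0.
rewrite ler_pdivlMr //; apply: le_trans M.
by rewrite le_eqVlt; apply/orP; left; apply/eqP; ring.
Qed.

End RMThreshold.

(** * Lower integrals and the decoding error *)

Section LowerIntegral.
Context d (X : measurableType d) (R : realType) (nu : {measure set X -> \bar R}).
Local Open Scope ereal_scope.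
Import HBNNSimple.

(* The integral of a nonnegative function is the supremum of the integrals of
   the simple functions below it, so that monotonicity and superadditivity hold
   without any measurability assumption. *)
Lemma lower_integral_le (f g : X -> \bar R) : (forall x, 0 <= f x) ->
  (forall x, f x <= g x) -> \int[nu]_x f x <= \int[nu]_x g x.
Proof.
move=> f0 fg; have g0 x : 0 <= g x by exact: le_trans (f0 x) (fg x).
rewrite !ge0_integralTE //; apply: ge_ereal_sup => _ [h /= hf <-].
by apply: ereal_sup_ubound; exists h => //= x; exact: le_trans (hf x) (fg x).
Qed.

Lemma lower_integralD (f g : X -> \bar R) : (forall x, 0 <= f x) ->
  (forall x, 0 <= g x) -> \int[nu]_x f x + \int[nu]_x g x <= \int[nu]_x (f x + g x).
Proof.
move=> f0 g0; have fg0 x : 0 <= f x + g x by rewrite adde_ge0.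
have lef : \int[nu]_x f x <= \int[nu]_x (f x + g x).
  by apply: lower_integral_le => // x; rewrite leeDl.
have leg : \int[nu]_x g x <= \int[nu]_x (f x + g x).
  by apply: lower_integral_le => // x; rewrite leeDr.
have If0 : 0 <= \int[nu]_x f x by exact: integral_ge0.
have Ig0 : 0 <= \int[nu]_x g x by exact: integral_ge0.
have [ffin|] := boolP (\int[nu]_x f x \is a fin_num); last first.
  rewrite ge0_fin_numE // -leNgt leye_eq => /eqP fy.
  by move: lef; rewrite fy leye_eq => /eqP ->; exact: leey.
have [gfin|] := boolP (\int[nu]_x g x \is a fin_num); last first.
  rewrite ge0_fin_numE // -leNgt leye_eq => /eqP gy.
  by move: leg; rewrite gy leye_eq => /eqP ->; exact: leey.
apply/lee_addgt0Pr => e e0.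
have e2 : (0 < e / 2)%R by rewrite divr_gt0.
rewrite ge0_integralTE // in ffin *; rewrite ge0_integralTE // in gfin *.
(* Simple functions within [e / 2] of each supremum; their sum lies below [f + g]. *)
have [_ [h hf <-] hlt] := ub_ereal_sup_adherent e2 ffin.
have [_ [k kg <-] klt] := ub_ereal_sup_adherent e2 gfin.
have hk : sintegral nu h + sintegral nu k <= \int[nu]_x (f x + g x).
  rewrite ge0_integralTE // -sintegralD; apply: ereal_sup_ubound.
  exists (h \+ k)%R => //= x.
  by rewrite EFinD; apply: leeD; [exact: hf | exact: kg].
move: hlt klt; rewrite !lteBlDr // => hlt klt.
apply: le_trans (leeD (ltW hlt) (ltW klt)) _.
rewrite addeACA -EFinD -splitr; exact: leeD2r.
Qed.

End LowerIntegral.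

Section IteratedIntegral.
Variables (R : realType) (nu : {measure set (\bar R) -> \bar R}).
Local Open Scope ereal_scope.
Implicit Types F G : seq (\bar R) -> \bar R.

Lemma iint_ge0 n F : (forall y, 0 <= F y) -> 0 <= iint nu n F.
Proof.
elim: n F => [|n IH] F F0 //=.
by apply: integral_ge0 => y _; exact: IH.
Qed.

Lemma iint_le n F G : (forall y, 0 <= F y) -> (forall y, F y <= G y) ->
  iint nu n F <= iint nu n G.
Proof.
elim: n F G => [|n IH] F G F0 FG //=.
by apply: lower_integral_le => y; [exact: iint_ge0 | exact: IH].
Qed.

Lemma iintD n F G : (forall y, 0 <= F y) -> (forall y, 0 <= G y) ->
  iint nu n F + iint nu n G <= iint nu n (fun y => F y + G y).
Proof.
elim: n F G => [|n IH] F G F0 G0 //=.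
apply: le_trans (lower_integralD _ _ _) _.
- by move=> y; exact: iint_ge0.
- by move=> y; exact: iint_ge0.
apply: lower_integral_le => y; first by apply: adde_ge0; exact: iint_ge0.
exact: IH.
Qed.

Lemma iint_sum n (A : Type) (r : seq A) (P : pred A) (F : A -> seq (\bar R) -> \bar R) :
  (forall a y, 0 <= F a y) ->
  \sum_(a <- r | P a) iint nu n (F a) <= iint nu n (fun y => \sum_(a <- r | P a) F a y).
Proof.
move=> F0; elim: r => [|a r IH].
  by rewrite big_nil; apply: iint_ge0 => y; rewrite big_nil.
have S0 y : 0 <= \sum_(a <- r | P a) F a y by apply: sume_ge0.
rewrite big_cons; case: ifP => Pa.
  apply: le_trans (leeD2l _ IH) _; apply: le_trans (iintD _ (F0 a) S0) _.
  by apply: iint_le => y; [rewrite adde_ge0 | rewrite big_cons Pa].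
by apply: le_trans IH _; apply: iint_le => y //; rewrite big_cons Pa.
Qed.

(** Exact evaluation for finite sums of product functions. In the induction the factor of the first
    output is absorbed into the coefficient [c]. *)
Lemma iint_products n (A : Type) (r : seq A) (c : A -> R) (h : A -> nat -> \bar R -> R)
    (v : A -> nat -> R) :
  (forall a, 0 <= c a)%R -> (forall a j y, 0 <= h a j y)%R ->
  (forall a j, measurable_fun setT (h a j)) ->
  (forall a j, \int[nu]_y (h a j y)%:E = (v a j)%:E) ->
  iint nu n (fun y => (\sum_(a <- r) c a * \prod_(j < n) h a j (nth 0 y j))%:E) =
  (\sum_(a <- r) c a * \prod_(j < n) v a j)%:E.
Proof.
elim: n c h v => [|n IH] c h v c0 h0 mh hv /=.
  by congr EFin; apply: eq_bigr => a _; rewrite !big_ord0.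
have v0 a j : (0 <= v a j)%R.
  by rewrite -lee_fin -hv; apply: integral_ge0 => y _; rewrite lee_fin.
under eq_integral => y _.
  under [X in iint _ _ X]eq_fun => s.
    under eq_bigr do rewrite big_ord_recl /= mulrA.
    over.
  rewrite (IH (fun a => c a * h a 0%N y)%R (fun a j => h a j.+1) (fun a j => v a j.+1)) //;
    last first.
    by move=> a; rewrite mulr_ge0.
  rewrite -sumEFin.
  under eq_bigr do rewrite mulrAC EFinM.
  over.
rewrite ge0_integral_sum //.
- rewrite -sumEFin; apply: eq_bigr => a _.
  rewrite ge0_integralZl_EFin //.
  + by rewrite hv -EFinM big_ord_recl mulrA mulrAC.
  + by move=> y _; rewrite lee_fin.
  + exact/measurable_EFinP.
  + by rewrite mulr_ge0 // prodr_ge0.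
- move=> a; apply: measurable_funeM; exact/measurable_EFinP.
- by move=> a y _; rewrite -EFinM lee_fin !mulr_ge0 // prodr_ge0.
Qed.

End IteratedIntegral.

Section DecodingError.
Variables (R : realType) (nu : {measure set (\bar R) -> \bar R}) (w : \bar R -> R).
Variables (T : finType) (ker : T -> \bar R -> R) (W : bool -> T -> R).
Hypothesis (w0 : forall y, 0 <= w y).
Hypothesis (ker0 : forall c y, 0 <= ker c y).
Hypothesis (ker1 : forall y, \sum_c ker c y = 1).
Hypothesis (mker : forall c b, measurable_fun setT (fun y => ker c y * chan_dens w (bpsk R b) y)).
Hypothesis (Wker : forall c b,
  (\int[nu]_y (ker c y * chan_dens w (bpsk R b) y)%:E = (W b c)%:E)%E).

Lemma chan_dens_ge0 x y : 0 <= chan_dens w x y.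
Proof. by rewrite /chan_dens; case: ifP. Qed.

Lemma lik_ge0 N (u : {ffun 'I_N -> bool}) y : 0 <= lik w u y.
Proof. by apply: prodr_ge0 => j _; exact: chan_dens_ge0. Qed.

Lemma bpsk_eq (b b' : bool) : (bpsk R b == bpsk R b') = (b == b').
Proof. by apply/idP/idP => [|/eqP -> //]; rewrite /bpsk => /eqP/signr_inj ->. Qed.

(* [x] is the mean of an arbitrary randomized decision with values in {-1, 1}. *)
Lemma MAP_optimal N (C : {set {ffun 'I_N -> bool}}) (i : 'I_N) y (x : R) : `|x| <= 1 ->
  \sum_(u in C) (bpsk R (u i) != bitMAP w C i y)%:R * lik w u y <=
  \sum_(u in C) (1 - (-1) ^+ (u i) * x) / 2 * lik w u y.
Proof.
rewrite ler_norml => /andP[x1 x2].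
pose a := \sum_(u in C | ~~ u i) lik w u y; pose b := \sum_(u in C | u i) lik w u y.
have a0 : 0 <= a by apply: sumr_ge0 => u _; exact: lik_ge0.
have b0 : 0 <= b by apply: sumr_ge0 => u _; exact: lik_ge0.
have splitC (F : bool -> R) : \sum_(u in C) F (u i) * lik w u y = F false * a + F true * b.
  rewrite (bigID (fun u : {ffun 'I_N -> bool} => u i)) /= addrC /a /b !mulr_sumr.
  by congr (_ + _); apply: eq_bigr => u /andP[_]; [move=> /negPf -> | move=> ->].
rewrite (splitC (fun c => (bpsk R c != bitMAP w C i y)%:R)) (splitC (fun c => (1 - (-1) ^+ c *
  x) / 2)).
rewrite expr1 expr0 /bitMAP.
have pE c : posterior w C i (bpsk R c) y = (#|C|%:R^-1 * (if c then b else a)) / (#|C|%:R^-1 *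
  (a + b)).
  rewrite /posterior -!mulr_sumr; congr (_ * _ / (_ * _)).
    by case: c; apply: eq_bigl => u; rewrite bpsk_eq ?eqb_id // eqbF_neg.
  by have := splitC (fun=> 1); rewrite !mul1r => <-; apply: eq_bigr => u _; rewrite mul1r.
have E1 : 1 = bpsk R false by rewrite /bpsk expr0.
have E2 : -1 = bpsk R true by rewrite /bpsk expr1.
have -> : posterior w C i 1 y = posterior w C i (bpsk R false) y by rewrite -E1.
have -> : posterior w C i (-1) y = posterior w C i (bpsk R true) y by rewrite -E2.
rewrite !pE.
(* A zero denominator makes both posteriors 0 by convention; then [a = b = 0] and both sides
   vanish. *)
case: (boolP (#|C|%:R^-1 * (a + b) == 0)) => [|D0].
  rewrite mulf_eq0 invr_eq0 => /orP[/eqP C0|/eqP ab].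
    have C00 : C = finset.set0 by apply/eqP; rewrite -cards_eq0 -(pnatr_eq0 R) C0.
    have aE : a = 0 by rewrite /a C00 big1 // => u; rewrite inE.
    have bE : b = 0 by rewrite /b C00 big1 // => u; rewrite inE.
    by rewrite aE bE !mulr0.
  have aE : a = 0 by lra.
  have bE : b = 0 by lra.
  by rewrite aE bE !mulr0.
have Dp : 0 < #|C|%:R^-1 * (a + b) by rewrite lt_neqAle eq_sym D0 mulr_ge0 // ?invr_ge0 //
  addr_ge0.
have Cp : 0 < #|C|%:R^-1 :> R.
  by rewrite lt_neqAle invr_ge0 ler0n andbT eq_sym; apply: contraNneq D0 => ->; rewrite mul0r.
rewrite ler_pM2r ?invr_gt0 // ler_pM2l //.
case: (lerP b a) => ab.
  have H c : (bpsk R c != 1) = c by rewrite E1 bpsk_eq; case: c.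
  have := mulr_ge0 (_ : 0 <= a - b) (_ : 0 <= 1 - x); rewrite !subr_ge0 => /(_ ab x2).
  by rewrite !H /= mul0r; lra.
have H c : (bpsk R c != -1) = ~~ c by rewrite E2 bpsk_eq; case: c.
have := mulr_ge0 (_ : 0 <= b - a) (_ : 0 <= x - -1); rewrite !subr_ge0 => /(_ (ltW ab) x1).
by rewrite !H /= mul0r; lra.
Qed.

Lemma sum_ker_prod N (y : seq (\bar R)) :
  \sum_(c : {ffun 'I_N -> T}) \prod_(j < N) ker (c j) (nth 0%E y j) = 1.
Proof.
by rewrite -(bigA_distr_bigA (fun j z => ker z (nth 0%E y (j : 'I_N)))) big1.
Qed.

(** Superadditivity moves the sum over codewords under the integral. There [MAP_optimal] is applied
    at each [y] with the mean of [g] over the randomized quantization of [y], which leaves a finite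
    sum of products. *)
Lemma bit_err_le N (C : {set {ffun 'I_N -> bool}}) (i : 'I_N) (g : {ffun 'I_N -> T} -> R) :
  (forall c, `|g c| <= 1) ->
  (bit_err nu w C i <=
  (#|C|%:R^-1 * \sum_(u in C) \sum_(c : {ffun 'I_N -> T})
     (1 - (-1) ^+ (u i) * g c) / 2 * \prod_j W (u j) (c j))%:E)%E.
Proof.
move=> g1.
have F0 (u : {ffun 'I_N -> bool}) y : (0 <= ((bpsk R (u i) != bitMAP w C i y)%:R * lik w u
  y)%:E)%E.
  by rewrite lee_fin mulr_ge0 // lik_ge0.
rewrite /bit_err -ge0_sume_distrr; last by move=> u _; exact: iint_ge0.
rewrite EFinM; apply: lee_wpmul2l; first by rewrite lee_fin invr_ge0.
apply: le_trans (iint_sum _ _ _ _ F0) _.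
pose r := [seq x <- index_enum ({ffun 'I_N -> bool} * {ffun 'I_N -> T})%type | x.1 \in C].
pose ca (x : {ffun 'I_N -> bool} * {ffun 'I_N -> T}) := (1 - (-1) ^+ (x.1 i) * g x.2) / 2.
(* [insubd i j] extends the indexing to all naturals; the default [i] is never reached for
   [j < N]. *)
pose h (x : {ffun 'I_N -> bool} * {ffun 'I_N -> T}) (j : nat) (y : \bar R) :=
  ker (x.2 (insubd i j)) y * chan_dens w (bpsk R (x.1 (insubd i j))) y.
pose v (x : {ffun 'I_N -> bool} * {ffun 'I_N -> T}) (j : nat) := W (x.1 (insubd i j)) (x.2
  (insubd i j)).
have ca0 x : 0 <= ca x.
  rewrite divr_ge0 // subr_ge0; apply: le_trans (ler_norm _) _.
  by rewrite normrM normr_sign mul1r.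
have := @iint_products R nu N _ r ca h v ca0.
move=> /(_ (fun x j y => mulr_ge0 (ker0 _ _) (chan_dens_ge0 _ _))
  (fun x j => mker _ _) (fun x j => Wker _ _)) E.
have sE (G : {ffun 'I_N -> bool} * {ffun 'I_N -> T} -> R) :
    \sum_(x <- r) G x = \sum_(u in C) \sum_(c : {ffun 'I_N -> T}) G (u, c).
  rewrite /r big_filter [RHS](pair_big (mem C) xpredT (fun u c => G (u, c))) /=.
  by apply: eq_big => [[u c]|[u c]] //=; rewrite andbT.
rewrite [X in (_ <= X)%E](_ : _ = (\sum_(x <- r) ca x * \prod_(j < N) v x j)%:E); last first.
  congr EFin; rewrite sE; apply: eq_bigr => u _; apply: eq_bigr => c _; congr (_ * _).
  by apply: eq_bigr => j _; rewrite /v valKd.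
rewrite -E; apply: iint_le => y; first by apply: sume_ge0.
rewrite sumEFin lee_fin sE.
pose G := \sum_(c : {ffun 'I_N -> T}) (\prod_(j < N) ker (c j) (nth 0%E y j)) * g c.
have G1 : `|G| <= 1.
  rewrite -(sum_ker_prod N y); apply: le_trans (ler_norm_sum _ _ _) _.
  apply: ler_sum => c _; have k0 : 0 <= \prod_(j < N) ker (c j) (nth 0%E y j) by apply: prodr_ge0.
  by rewrite normrM (ger0_norm k0) ler_piMr.
apply: le_trans (MAP_optimal C i y G1) _.
rewrite le_eqVlt; apply/orP; left; apply/eqP; apply: eq_bigr => u _.
have -> : (1 - (-1) ^+ u i * G) / 2 =
    \sum_(c : {ffun 'I_N -> T}) (1 - (-1) ^+ u i * g c) / 2 * \prod_(j < N) ker (c j) (nth 0%E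
      y j).
  rewrite -[X in (X - _) / 2](sum_ker_prod N y) /G mulr_sumr -sumrB mulr_suml.
  by apply: eq_bigr => c _; field.
rewrite mulr_suml; apply: eq_bigr => c _; rewrite /ca /= -mulrA; congr (_ * _).
rewrite /lik -big_split /=; apply: eq_bigr => j _.
by rewrite /h /= valKd.
Qed.

End DecodingError.

Section DecodingErrorMu.
Variables (R : realType) (nu : {measure set (\bar R) -> \bar R}) (w : \bar R -> R).
Variables (T : finType) (s : T -> T) (e : T) (q : T -> R) (ker : T -> \bar R -> R).
Hypothesis (w0 : forall y, 0 <= w y).
Hypothesis (sK : involutive s).
Hypothesis (se : s e = e).
Hypothesis (q0 : forall z, 0 < q z).
Hypothesis (q1 : \sum_z q z = 1).
Hypothesis (ker0 : forall c y, 0 <= ker c y).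
Hypothesis (ker1 : forall y, \sum_c ker c y = 1).
Hypothesis (mker : forall c b, measurable_fun setT (fun y => ker c y * chan_dens w (bpsk R b) y)).
Hypothesis (Wker : forall c b, (\int[nu]_y (ker c y * chan_dens w (bpsk R b) y)%:E =
  (if b then q (s c) else q c)%:E)%E).

Definition lratio (z : T) := q (s z) / q z.

Lemma lratio_gt0 z : 0 < lratio z.
Proof. by rewrite divr_gt0. Qed.

Lemma lratio_s z : lratio (s z) = (lratio z)^-1.
Proof. by rewrite /lratio sK invf_div. Qed.

Lemma q_symlaw : symlaw s lratio q.
Proof.
split; first by split=> // z; exact: ltW.
by move=> z; rewrite /lratio mulrCA mulfV ?mulr1 // lt0r_neq0.
Qed.

(** The competing rule is the extrinsic posterior mean, used as a randomized decision; by
    equivariance its error is the same for every codeword. *)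
Lemma bit_err_mu N (C : {set {ffun 'I_N -> bool}}) (i : 'I_N) : linear_code C ->
  (bit_err nu w C i <= ((1 - mu lratio e q C i 1) / 2)%:E)%E.
Proof.
move=> Clin; pose g c := pmean lratio C i (upd c i e).
have geq : equivariant s C i g.
  exact: (erase_equivariant lratio_gt0 lratio_s se Clin).
have g1 c : `|g c| <= 1 by exact: (pmean_le1 lratio_gt0 Clin).
apply: le_trans (bit_err_le w0 ker0 ker1 mker Wker C i g1) _.
rewrite lee_fin; have Cp := cardC_gt0 R Clin.
have mE : mu lratio e q C i 1 = Ex (fun=> q) g.
  transitivity (Ex (set_law (fun=> q) i (pt_mass R e)) (pmean lratio C i)).
    apply: eq_Ex_law => j z; rewrite /elaw /set_law inE; case: eqP => // _.
    by rewrite subrr mul0r add0r mul1r.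
  rewrite Ex_resample //; apply: eq_Ex => y.
  by rewrite (sum_pt_mass e (fun z => pmean lratio C i (upd y i z))).
rewrite mE (eq_bigr (fun=> (1 - Ex (fun=> q) g) / 2)); last first.
  move=> u uC.
  transitivity (Ex (fun=> q) (fun c => wt lratio u c * ((1 - (-1) ^+ u i * g c) / 2))).
    apply: eq_bigr => c _; rewrite mulrA mulrC; congr (_ * _).
    rewrite -big_split /=; apply: eq_bigr => j _; case: (u j); rewrite ?mulr1 //.
    by have [_ ->] := q_symlaw.
  rewrite (Ex_wt sK (fun _ => q_symlaw) u (fun c => (1 - (-1) ^+ u i * g c) / 2)).
  rewrite -[X in X - _](@Ex_cst _ _ 'I_N (fun=> q) 1) // -ExB mulrC -ExZ; apply: eq_Ex => c.
  by rewrite geq // mulrA -expr2 sqrr_sign mul1r mulrC.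
by rewrite sumr_const -[X in _ * X]mulr_natl mulKf // lt0r_neq0.
Qed.

End DecodingErrorMu.

(** * Quantization of the channel output *)

Section RealInequalities.
Variable R : realType.

Definition xlogx (a p : R) : R := if a == 0 then 0 else a * ln (a / p).

Lemma xlogx_le (a p r : R) : 0 <= a -> 0 < p -> 0 < r ->
  xlogx a p <= a * ln r + a * (a / (p * r) - 1).
Proof.
move=> a0 p0 r0; rewrite /xlogx; case: (eqVneq a 0) => [->|an]; first by rewrite !mul0r addr0.
have ap : 0 < a by rewrite lt_neqAle eq_sym an.
rewrite -mulrDr ler_wpM2l // -lerBlDl -ln_div ?posrE ?divr_gt0 //.
have -> : a / (p * r) = a / p / r by rewrite invfM mulrA.
by apply: ln_le_sub1; rewrite !divr_gt0.
Qed.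

Lemma xlogx_ge (a p : R) : 0 <= a -> 0 < p -> a - p <= xlogx a p.
Proof.
move=> a0 p0; rewrite /xlogx; case: (eqVneq a 0) => [->|an]; first by rewrite sub0r oppr_le0 ltW.
have ap : 0 < a by rewrite lt_neqAle eq_sym an.
have := ln_le_sub1 (divr_gt0 p0 ap).
rewrite -[p / a]invf_div lnV ?posrE ?divr_gt0 // => /(ler_wpM2l a0).
rewrite mulrBr mulrN mulr1 [(a / p)^-1]invf_div mulrCA mulfV // mulr1; lra.
Qed.

(* Relative entropy is at most chi-square distance; this bounds the loss caused by
   replacing the exact log-likelihoods of a cell by those of a fixed bias [r]. *)
Lemma xlogx2_le (a b r : R) : 0 <= a -> 0 <= b -> 0 < a + b -> -1 < r -> r < 1 ->
  xlogx a ((a + b) / 2) + xlogx b ((a + b) / 2) <=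
  a * ln (1 + r) + b * ln (1 - r) + (a + b) * (((a - b) / (a + b) - r) ^+ 2 / (1 - r ^+ 2)).
Proof.
move=> a0 b0 ab r1 r2; have p0 : 0 < (a + b) / 2 by rewrite divr_gt0.
have ra : 0 < 1 + r by lra.
have rb : 0 < 1 - r by lra.
apply: le_trans (lerD (xlogx_le a0 p0 ra) (xlogx_le b0 p0 rb)) _.
rewrite le_eqVlt; apply/orP; left; apply/eqP.
have r2n : 1 - r ^+ 2 != 0 by rewrite -(expr1n _ 2) subr_sqr mulf_neq0 // lt0r_neq0.
by field; rewrite r2n !lt0r_neq0.
Qed.

(** The count is the integer part of [x] capped at [n]; the cap costs at most 1 because
    [x <= n + 1]. *)
Lemma count_floor n (x : R) : 0 <= x -> x <= n.+1%:R ->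
  x - 1 <= \sum_(j < n) ((j.+1%:R <= x)%R)%:R <= x.
Proof.
elim: n => [|n IH] x0 xn; first by rewrite big_ord0; apply/andP; split; lra.
rewrite big_ord_recr /=; case: (lerP n.+1%:R x) => nx; last first.
  by rewrite addr0; apply: IH => //; exact: ltW.
rewrite (eq_bigr (fun=> 1)); last first.
  move=> j _; rewrite (le_trans _ nx) // ler_nat.
  exact: (leq_trans (ltn_ord j)).
rewrite sumr_const card_ord -natrD addn1 nx andbT.
by rewrite -[n.+2]addn1 natrD in xn; lra.
Qed.

End RealInequalities.

Section Quantization.
Variables (R : realType) (nu : {measure set (\bar R) -> \bar R}) (w : \bar R -> R).
Hypothesis (BMS : is_BMS nu w).

Let w0 y : 0 <= w y. Proof. by case: BMS. Qed.
Let mw : measurable_fun setT w. Proof. by case: BMS. Qed.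
Let Iw : (\int[nu]_y (w y)%:E = 1)%E. Proof. by case: BMS. Qed.

Lemma measurable_opp_comp (f : \bar R -> R) : measurable_fun setT f ->
  measurable_fun setT (fun y : \bar R => f (- y)%E).
Proof. by move=> mf; apply: (measurableT_comp mf); exact: oppe_measurable. Qed.

Lemma integral_opp (f : \bar R -> R) : (forall y, 0 <= f y) -> measurable_fun setT f ->
  (\int[nu]_y (f (- y)%E)%:E = \int[nu]_y (f y)%:E)%E.
Proof.
move=> f0 mf; have [_ inv _ _ _] := BMS.
have mo : measurable_fun setT (-%E : \bar R -> \bar R) by exact: oppe_measurable.
have := @ge0_integral_pushforward _ _ _ _ R _ mo nu setT (EFin \o f) measurableT.
rewrite preimage_setT => <-.
- pose phi : {mfun (\bar R) >-> (\bar R)} := HB.pack (-%E : \bar R -> \bar R)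
  (isMeasurableFun.Build _ _ _ _ _ mo).
  have := @eq_measure_integral _ _ R setT nu (pushforward nu phi) (EFin \o f).
  by apply => A mA _; exact: inv.
- exact/measurable_EFinP.
- by move=> y _; rewrite lee_fin.
Qed.

Variable n : nat.
Local Notation S := {ffun 'I_n -> bool}.
Local Notation T := (S * S)%type.
Local Notation K := (n.+1%:R : R).

Definition above (j : 'I_n) (y : \bar R) : bool :=
  j.+1%:R * (w y + w (- y)%E) <= K * (w y - w (- y)%E).

Definition level (y : \bar R) : S := [ffun j => above j y].

(* The cell of [y] records the integer parts of [K * theta] and [- K * theta],
   where [theta = (w y - w (- y)) / (w y + w (- y))], both truncated to [0..n]. *)
Definition cellof (y : \bar R) : T := (level y, level (- y)%E).

Definition swap (c : T) : T := (c.2, c.1).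

Definition cell (c : T) (y : \bar R) : R := (cellof y == c)%:R.

Lemma swapK : involutive swap.
Proof. by case. Qed.

Lemma cell_opp c y : cell c (- y)%E = cell (swap c) y.
Proof.
rewrite /cell /cellof oppeK; congr (_%:R : R); case: c => c1 c2.
by rewrite /swap /= !xpair_eqE andbC.
Qed.

Lemma sum_cell y (F : T -> R) : \sum_c cell c y * F c = F (cellof y).
Proof.
rewrite (bigD1 (cellof y)) //= /cell eqxx mul1r big1 ?addr0 // => c /negPf cy.
by rewrite eq_sym cy mul0r.
Qed.

Lemma cell_ge0 c y : 0 <= cell c y.
Proof. exact: ler0n. Qed.

Lemma cell_le1 c y : cell c y <= 1.
Proof. by rewrite /cell; case: eqP. Qed.

Lemma measurable_cell c : measurable_fun setT (cell c).
Proof.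
have mo := measurable_opp_comp.
have mab j : measurable_fun setT (above j).
  apply: measurable_fun_ler.
    by apply: measurable_funM => //; apply: measurable_funD => //; exact: mo.
  by apply: measurable_funM => //; apply: measurable_funB => //; exact: mo.
have mI j b : measurable_fun setT (fun y => (above j y == b)%:R : R).
  rewrite (_ : (fun y => _) = (fun y => if above j y then (true == b)%:R else (false == b)%:R)).
    exact: measurable_fun_ifT.
  by apply/funext => y; case: (above j y).
rewrite (_ : cell c = (fun y => (\prod_j (above j y == c.1 j)%:R) *
    (\prod_j (above j (- y)%E == c.2 j)%:R))).
  apply: measurable_funM; first by apply: measurable_prod => j _; exact: mI.
  apply: measurable_prod => j _; apply: (mo (fun y => (above j y == c.2 j)%:R)); exact: mI.
apply/funext => y; rewrite /cell; case: c => c1 c2 /=.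
have P (z : \bar R) (u : S) : \prod_j (above j z == u j)%:R = (level z == u)%:R :> R.
  case: (eqVneq (level z) u) => [<-|zu]; first by apply: big1 => j _; rewrite ffunE eqxx.
  have [j zj] : exists j, above j z != u j.
    apply/existsP; rewrite -[X in is_true X]negbK negb_exists; apply/negP => /forallP h.
    case/eqP: zu; apply/ffunP => j; rewrite ffunE.
    by have := h j; rewrite negbK => /eqP.
  by rewrite (bigD1 j) //= (negPf zj) mul0r.
by rewrite !P xpair_eqE -natrM mulnb.
Qed.

Lemma integrable_w : nu.-integrable setT (EFin \o w).
Proof.
apply/integrableP; split; first exact/measurable_EFinP.
rewrite (_ : (\int[nu]_x _)%E = 1%E) ?ltry // -Iw; apply: eq_integral => y _ /=.
by rewrite ger0_norm.
Qed.

Lemma integrable_wopp : nu.-integrable setT (fun y => (w (- y)%E)%:E).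
Proof.
apply/integrableP; split; first exact/measurable_EFinP/measurable_opp_comp.
rewrite (_ : (\int[nu]_x _)%E = 1%E) ?ltry // -Iw -(integral_opp w0 mw).
by apply: eq_integral => y _ /=; rewrite ger0_norm.
Qed.

Lemma integrable_cell (f : \bar R -> R) c : (forall y, 0 <= f y) -> measurable_fun setT f ->
  nu.-integrable setT (fun y => (f y)%:E) -> nu.-integrable setT (fun y => (cell c y * f y)%:E).
Proof.
move=> f0 mf; apply: le_integrable => //.
  apply/measurable_EFinP/measurable_funM => //; exact: measurable_cell.
move=> y _ /=; rewrite lee_fin !ger0_norm ?mulr_ge0 ?cell_ge0 //.
by rewrite ler_piMl // cell_le1.
Qed.

Definition Acell (c : T) : R := fine (\int[nu]_y (cell c y * w y)%:E)%E.

Lemma integral_cell c : (\int[nu]_y (cell c y * w y)%:E = (Acell c)%:E)%E.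
Proof.
rewrite fineK //; apply: integrable_fin_num => //; apply: integrable_cell => //.
exact: integrable_w.
Qed.

Lemma integral_cell_opp c : (\int[nu]_y (cell c y * w (- y)%E)%:E = (Acell (swap c))%:E)%E.
Proof.
rewrite -integral_cell -[RHS](@integral_opp (fun y => cell (swap c) y * w y)).
- by apply: eq_integral => y _; rewrite cell_opp swapK.
- by move=> y; rewrite mulr_ge0 // cell_ge0.
- by apply: measurable_funM => //; exact: measurable_cell.
Qed.

Lemma Acell_ge0 c : 0 <= Acell c.
Proof.
rewrite -lee_fin -integral_cell; apply: integral_ge0 => y _.
by rewrite lee_fin mulr_ge0 // cell_ge0.
Qed.

Lemma sum_Acell : \sum_c Acell c = 1.
Proof.
apply: EFin_inj; rewrite -sumEFin -Iw.
rewrite (eq_bigr (fun c => \int[nu]_y (cell c y * w y)%:E)%E); last first.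
  by move=> c _; rewrite integral_cell.
rewrite -ge0_integral_sum //.
- apply: eq_integral => y _; rewrite sumEFin; congr EFin.
  exact: (sum_cell y (fun=> w y)).
- move=> c; apply/measurable_EFinP/measurable_funM => //; exact: measurable_cell.
- by move=> c y _; rewrite lee_fin mulr_ge0 // cell_ge0.
Qed.

(** The value of [theta] recorded by the cell, exact up to [1 / K]. Dividing counts of at most [n]
    by [n + 1] keeps it away from 1 and -1, so the logarithms of [1 + rho] stay finite. *)
Definition rho (c : T) : R := (\sum_j (c.1 j)%:R - \sum_j (c.2 j)%:R) / K.

Lemma rho_swap c : rho (swap c) = - rho c.
Proof. by rewrite /rho /= -mulNr opprB. Qed.

Let K0 : 0 < K. Proof. by rewrite ltr0n. Qed.
Let KE : K = n%:R + 1. Proof. by rewrite -natr1. Qed.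

Lemma rho_bound c : 1 / K <= 1 - `|rho c|.
Proof.
have b (u : S) : 0 <= (\sum_j (u j)%:R : R) <= n%:R.
  apply/andP; split; first by apply: sumr_ge0 => j _; exact: ler0n.
  rewrite -[X in X%:R]card_ord -sumr_const; apply: ler_sum => j _.
  by case: (u j).
have /andP[h1 h2] := b c.1; have /andP[h3 h4] := b c.2.
rewrite lerBrDl -lerBrDr; apply: (@le_trans _ _ (n%:R / K)).
  rewrite /rho normrM normfV (gtr0_norm K0) ler_wpM2r ?invr_ge0 ?(ltW K0) //.
  by rewrite ler_norml; apply/andP; split; lra.
by rewrite le_eqVlt KE; apply/orP; left; apply/eqP; field; rewrite -KE lt0r_neq0.
Qed.

Lemma rho_itv c : -1 < rho c /\ rho c < 1.
Proof.
have := rho_bound c; have : 0 < 1 / K by rewrite divr_gt0.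
move=> h1 h2; have : `|rho c| < 1 by rewrite -subr_gt0; exact: lt_le_trans h1 h2.
by rewrite ltr_norml => /andP.
Qed.

Lemma rho_sqr c : 1 / K <= 1 - rho c ^+ 2.
Proof.
apply: le_trans (rho_bound c) _; rewrite -real_normK ?num_real //.
have [h1 h2] := rho_itv c; have : `|rho c| < 1 by rewrite ltr_norml h1.
by have := normr_ge0 (rho c); nra.
Qed.

Lemma level_pos (y : \bar R) : 0 < w y + w (- y)%E -> w (- y)%E <= w y ->
  K * ((w y - w (- y)%E) / (w y + w (- y)%E)) - 1 <=
    \sum_j (level y j)%:R <= K * ((w y - w (- y)%E) / (w y + w (- y)%E)).
Proof.
move=> ab ba; set a := w y in ab ba *; set b := w (- y)%E in ab ba *.
have b0 : 0 <= b by exact: w0.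
have h0 : 0 <= K * ((a - b) / (a + b)).
  by rewrite mulr_ge0 ?(ltW K0) // divr_ge0 ?subr_ge0 // ltW.
have h1 : K * ((a - b) / (a + b)) <= n.+1%:R.
  by rewrite ger_pMr // ler_pdivrMr // mul1r; lra.
have := count_floor h0 h1; rewrite (eq_bigr (fun j => (level y j)%:R)) // => j _.
by rewrite ffunE /above -/a -/b mulrA ler_pdivlMr.
Qed.

Lemma level_neg (y : \bar R) : 0 < w y + w (- y)%E -> w y <= w (- y)%E ->
  \sum_j (level y j)%:R = 0 :> R.
Proof.
move=> ab ba; apply: big1 => j _; rewrite ffunE /above leNgt.
rewrite (@le_lt_trans _ _ 0) //; first by rewrite mulr_ge0_le0 ?(ltW K0) // subr_le0.
by rewrite mulr_gt0 // ltr0n.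
Qed.

Lemma rho_close (y : \bar R) : 0 < w y + w (- y)%E ->
  ((w y - w (- y)%E) / (w y + w (- y)%E) - rho (cellof y)) ^+ 2 <= (1 / K) ^+ 2.
Proof.
move=> ab; have ab' : 0 < w (- y)%E + w (- - y)%E by rewrite oppeK addrC.
set th := (w y - w (- y)%E) / (w y + w (- y)%E).
have iK : K * (1 / K) = 1 by rewrite mul1r mulfV // lt0r_neq0.
suff : `|th - rho (cellof y)| <= 1 / K.
  by move=> h; rewrite -[leLHS]real_normK ?num_real // lerXn2r ?nnegrE // divr_ge0 // ltW.
have Kr : K * rho (cellof y) = \sum_j (level y j)%:R - \sum_j (level (- y)%E j)%:R.
  by rewrite /rho mulrCA mulfV ?mulr1 // lt0r_neq0.
rewrite -(ler_pM2l K0) -{1}(gtr0_norm K0) -normrM mulrBr Kr iK ler_norml.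
case: (lerP (w (- y)%E) (w y)) => ba.
  rewrite (@level_neg (- y)%E) // ?oppeK // subr0.
  have := level_pos ab ba; rewrite -/th => /andP[h1 h2].
  by apply/andP; split; lra.
rewrite (@level_neg y) ?(ltW ba) // sub0r opprK.
have := @level_pos (- y)%E ab'; rewrite oppeK => /(_ (ltW ba)).
have -> : (w (- y)%E - w y) / (w (- y)%E + w y) = - th.
  by rewrite /th [w (- y)%E + w y]addrC -mulNr opprB.
by rewrite mulrN => /andP[h1 h2]; apply/andP; split; lra.
Qed.

Let cap_pt (y : \bar R) : R := (plog2 (chan_dens w 1 y) (out_dens w y)
              + plog2 (chan_dens w (-1) y) (out_dens w y)) / 2.

Let ln2 : 0 < ln 2 :> R. Proof. by apply: ln_gt0; rewrite ltr1n. Qed.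

Let cap_ptE y : cap_pt y =
  (xlogx (w y) ((w y + w (- y)%E) / 2) + xlogx (w (- y)%E) ((w y + w (- y)%E) / 2)) / (2 * ln 2).
Proof.
have N11 : (-1 == 1 :> R) = false by apply/eqP; lra.
rewrite /cap_pt /out_dens /chan_dens eqxx N11 /plog2 /xlogx.
by case: ifP => _; case: ifP => _; field; rewrite lt0r_neq0.
Qed.

Lemma cap_pt_ge0 y : 0 <= cap_pt y.
Proof.
rewrite cap_ptE divr_ge0 ?mulr_ge0 ?(ltW ln2) //.
have := w0 y; have := w0 (- y)%E; set a := w y; set b := w (- y)%E => b0 a0.
have [ab|ab] := ltP 0 (a + b).
  have p0 : 0 < (a + b) / 2 by rewrite divr_gt0.
  have := xlogx_ge a0 p0; have := xlogx_ge b0 p0; lra.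
have -> : a = 0 by lra.
have -> : b = 0 by lra.
by rewrite /xlogx eqxx addr0.
Qed.

Definition acoef (c : T) : R := (ln (1 + rho c) + 1 / K) / (2 * ln 2).

(** The chi-square loss of [xlogx2_le] is at most [(1 / K)^2 / (1 - rho^2)], hence at most [1 / K]
    by [rho_sqr]. *)
Lemma cap_pt_le y : cap_pt y <=
  acoef (cellof y) * w y + acoef (swap (cellof y)) * w (- y)%E.
Proof.
rewrite cap_ptE /acoef rho_swap.
have := w0 y; have := w0 (- y)%E => b0 a0.
have l22 : 0 < 2 * ln 2 :> R by rewrite mulr_gt0.
have [ab|ab] := ltP 0 (w y + w (- y)%E); last first.
  have -> : w y = 0 by lra.
  have -> : w (- y)%E = 0 by lra.
  by rewrite /xlogx eqxx addr0 !mul0r !mulr0 addr0.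
have [r1 r2] := rho_itv (cellof y).
have := xlogx2_le a0 b0 ab r1 r2.
have rs := rho_sqr (cellof y); have rc := rho_close ab.
set th := (_ / _ - rho _) in rc *; set D := 1 - rho _ ^+ 2 in rs *.
have iK : 0 < 1 / K by rewrite divr_gt0.
have D0 : 0 < D by exact: lt_le_trans rs.
have H : th ^+ 2 / D <= 1 / K.
  by rewrite ler_pdivrMr //; apply: le_trans rc _; rewrite expr2 ler_wpM2l // ltW.
have {}H := ler_wpM2l (ltW ab) H.
move=> H2; have {H2}H := le_trans H2 (lerD (lexx _) H).
rewrite ler_pdivrMr //; apply: le_trans H _.
rewrite le_eqVlt; apply/orP; left; apply/eqP; field.
by rewrite !lt0r_neq0.
Qed.

Lemma capacity_le : (capacity nu w <= ((\sum_c Acell c * ln (1 + rho c) + 1 / K) / ln 2)%:E)%E.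
Proof.
pose U y := (\sum_c ((acoef c)%:E * (cell c y * w y)%:E +
   (acoef (swap c))%:E * (cell c y * w (- y)%E)%:E))%E.
have i1 c : nu.-integrable setT (fun y => ((acoef c)%:E * (cell c y * w y)%:E)%E).
  by apply: integrableZl => //; apply: integrable_cell => //; exact: integrable_w.
have i2 c : nu.-integrable setT (fun y => ((acoef (swap c))%:E * (cell c y * w (- y)%E)%:E)%E).
  apply: integrableZl => //; apply: (@integrable_cell (fun y => w (- y)%E)) => //.
    exact: measurable_opp_comp.
  exact: integrable_wopp.
have UE : (\int[nu]_y U y = ((\sum_c Acell c * ln (1 + rho c) + 1 / K) / ln 2)%:E)%E.
  rewrite /U integral_sum //; last by move=> c; apply: integrableD.
  rewrite (eq_bigr (fun c => (acoef c * Acell c + acoef (swap c) * Acell (swap c))%:E)); last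
    first.
    move=> c _; rewrite integralD // !integralZl //.
    - by rewrite integral_cell integral_cell_opp.
    - apply: (@integrable_cell (fun y => w (- y)%E)) => //; first exact: measurable_opp_comp.
      exact: integrable_wopp.
    - by apply: integrable_cell => //; exact: integrable_w.
  rewrite sumEFin; congr EFin; rewrite big_split /=.
  rewrite -(reindex_inj (inv_inj swapK) (P := xpredT) (F := fun c => acoef c * Acell c)).
  transitivity ((\sum_c Acell c * ln (1 + rho c) + 1 / K * \sum_c Acell c) / ln 2); last first.
    by rewrite sum_Acell mulr1.
  rewrite mulr_sumr -!big_split mulr_suml /=; apply: eq_bigr => c _.
  by rewrite /acoef; field; rewrite !lt0r_neq0.
rewrite -UE /capacity; apply: lower_integral_le => y; first by rewrite lee_fin cap_pt_ge0.
rewrite /U (eq_bigr (fun c => (cell c y * (acoef c * w y + acoef (swap c) * w (- y)%E))%:E));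
  last first.
  by move=> c _; rewrite -!EFinM -EFinD; congr EFin; ring.
rewrite sumEFin lee_fin (sum_cell y (fun c => acoef c * w y + acoef (swap c) * w (- y)%E)).
exact: cap_pt_le.
Qed.

Section Softening.
Variable eps : R.
Hypothesis (e0 : 0 < eps).
Hypothesis (e1 : eps < 1).

Let u : R := #|{: T}|%:R^-1.

Let card0 : 0 < #|{: T}|%:R :> R.
Proof. by rewrite ltr0n; apply/card_gt0P; exists ([ffun=> false], [ffun=> false]). Qed.

(** With probability [eps] the cell is replaced by a uniform one, which makes every likelihood ratio
    finite and positive. *)
Definition ker (c : T) (y : \bar R) : R := (1 - eps) * cell c y + eps * u.
Definition qlaw (c : T) : R := (1 - eps) * Acell c + eps * u.

Lemma sum_u : \sum_(c : T) u = 1.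
Proof. by rewrite sumr_const -[_ *+ #|_|]mulr_natr mulVf // lt0r_neq0. Qed.

Lemma ker_ge0 c y : 0 <= ker c y.
Proof.
rewrite addr_ge0 ?mulr_ge0 ?cell_ge0 ?subr_ge0 ?invr_ge0 ?(ltW e0) ?(ltW e1) //.
Qed.

Lemma sum_ker y : \sum_c ker c y = 1.
Proof.
rewrite big_split /= -!mulr_sumr sum_u.
have := sum_cell y (fun=> 1); under eq_bigr do rewrite mulr1.
by move=> ->; ring.
Qed.

Lemma qlaw_gt0 c : 0 < qlaw c.
Proof.
by rewrite ltr_wpDl ?mulr_ge0 ?Acell_ge0 ?subr_ge0 ?(ltW e1) // mulr_gt0 // invr_gt0.
Qed.

Lemma sum_qlaw : \sum_c qlaw c = 1.
Proof. by rewrite big_split /= -!mulr_sumr sum_u sum_Acell; ring. Qed.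

Lemma measurable_ker c : measurable_fun setT (ker c).
Proof.
apply: measurable_funD => //; apply: measurable_funM => //; exact: measurable_cell.
Qed.

Lemma measurable_chan b : measurable_fun setT (chan_dens w (bpsk R b)).
Proof.
rewrite /chan_dens; case: (bpsk R b == 1); first exact: mw.
exact: measurable_opp_comp.
Qed.

Lemma integral_ker c b : (\int[nu]_y (ker c y * chan_dens w (bpsk R b) y)%:E =
  (if b then qlaw (swap c) else qlaw c)%:E)%E.
Proof.
have N11 : (-1 == 1 :> R) = false by apply/eqP; lra.
pose f y := chan_dens w (bpsk R b) y.
have f0 y : 0 <= f y by exact: chan_dens_ge0.
have mf : measurable_fun setT f by exact: measurable_chan.
have If : (\int[nu]_y (f y)%:E = 1)%E.
  rewrite /f /chan_dens /bpsk; case: b {f f0 mf}; rewrite ?expr1 ?expr0 ?N11 ?eqxx //.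
  by rewrite (integral_opp w0 mw).
have Ic : (\int[nu]_y (cell c y * f y)%:E = (Acell (if b then swap c else c))%:E)%E.
  rewrite /f /chan_dens /bpsk; case: b {f f0 mf If}; rewrite ?expr1 ?expr0 ?N11 ?eqxx.
    exact: integral_cell_opp.
  exact: integral_cell.
transitivity (\int[nu]_y ((1 - eps)%:E * (cell c y * f y)%:E + (eps * u)%:E * (f y)%:E))%E.
  by apply: eq_integral => y _; rewrite -!EFinM -EFinD; congr EFin; rewrite /ker -/(f y); ring.
have mcf : measurable_fun setT (fun y => (cell c y * f y)%:E).
  by apply/measurable_EFinP/measurable_funM => //; exact: measurable_cell.
have mfE : measurable_fun setT (fun y => (f y)%:E) by exact/measurable_EFinP.
have e1' : 0 <= 1 - eps by rewrite subr_ge0 ltW.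
have eu : 0 <= eps * u by rewrite mulr_ge0 ?invr_ge0 // ltW.
have hc (y : \bar R) : setT y -> (0 <= (cell c y * f y)%:E)%E.
  by move=> _; rewrite lee_fin mulr_ge0 // cell_ge0.
have hf (y : \bar R) : setT y -> (0 <= (f y)%:E)%E by move=> _; rewrite lee_fin.
rewrite ge0_integralD //.
- rewrite (ge0_integralZl_EFin nu measurableT hc mcf e1').
  rewrite (ge0_integralZl_EFin nu measurableT hf mfE eu) Ic If -EFinM mule1 -EFinD.
  by congr EFin; case: b {f f0 mf If Ic mcf mfE hc hf}.
- by move=> y _; rewrite -EFinM lee_fin !mulr_ge0 // cell_ge0.
- exact: measurable_funeM.
- by move=> y _; rewrite -EFinM lee_fin !mulr_ge0 // ?invr_ge0 // ltW.
- exact: measurable_funeM.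
Qed.

(** Gibbs' inequality: guessing the bias [rho] instead of the true posterior loses information.
    After [ln x <= x - 1] the bounds sum to zero because [rho] is odd under [swap]. *)
Lemma phi_qlaw_ge : (1 - eps) * \sum_c Acell c * ln (1 + rho c) +
  eps * (u * \sum_c ln (1 + rho c)) <= phi (lratio swap qlaw) qlaw 0.
Proof.
have [q0 qs] := (qlaw_gt0, sum_qlaw).
have -> : (1 - eps) * \sum_c Acell c * ln (1 + rho c) + eps * (u * \sum_c ln (1 + rho c)) =
    \sum_c qlaw c * ln (1 + rho c).
  by rewrite !mulr_sumr -big_split /=; apply: eq_bigr => c _; rewrite /qlaw; ring.
have qsw : \sum_c qlaw (swap c) = 1.
  by rewrite -(reindex_inj (inv_inj swapK) (P := xpredT) (F := qlaw)).
have rsw : \sum_c rho c * qlaw (swap c) = - \sum_c rho c * qlaw c.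
  rewrite (reindex_inj (inv_inj swapK)) /= -sumrN; apply: eq_bigr => c _.
  by rewrite swapK rho_swap mulNr.
rewrite -subr_ge0 /phi -opprD -big_split /=.
have : \sum_c (qlaw c * ln (lmix (lratio swap qlaw) c 0) + qlaw c * ln (1 + rho c)) <=
    \sum_c ((1 + rho c) * (qlaw c + qlaw (swap c)) / 2 - qlaw c).
  apply: ler_sum => c _; have [r1 _] := rho_itv c.
  have rp : 0 < 1 + rho c by lra.
  have lp : 0 < lmix (lratio swap qlaw) c 0.
    by rewrite /lmix subr0 addr0 mul1r divr_gt0 // addr_gt0 // divr_gt0.
  rewrite -mulrDr -lnM ?posrE //.
  apply: le_trans (ler_wpM2l (ltW (q0 c)) (ln_le_sub1 (mulr_gt0 lp rp))) _.
  rewrite le_eqVlt; apply/orP; left; apply/eqP; rewrite /lmix /lratio; field.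
  by rewrite lt0r_neq0.
have -> : \sum_c ((1 + rho c) * (qlaw c + qlaw (swap c)) / 2 - qlaw c) = 0; last by lra.
rewrite sumrB qs -mulr_suml.
rewrite (eq_bigr (fun c => (qlaw c + qlaw (swap c)) + (rho c * qlaw c + rho c * qlaw (swap
  c)))); last first.
  by move=> c _; ring.
rewrite big_split /= [X in (X + _) / _]big_split /= [X in (_ + X) / _]big_split /= qs qsw rsw.
by field.
Qed.

End Softening.
End Quantization.

(** * Choice of the quantizer and passage to the limit *)

Lemma small_mixture (R : realType) (X Y r0 : R) : r0 < X ->
  exists eps, [/\ 0 < eps, eps < 1 & r0 < (1 - eps) * X + eps * Y].
Proof.
move=> rX; pose D := (X - r0) + `|X - Y| + 1; have n0 := normr_ge0 (X - Y).
have D0 : 0 < D by rewrite /D; lra.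
exists ((X - r0) / D); split.
- by rewrite divr_gt0 // subr_gt0.
- by rewrite ltr_pdivrMr // mul1r /D; lra.
have h : (X - r0) / D * (X - Y) < X - r0.
  rewrite mulrAC ltr_pdivrMr //; have := ler_norm (X - Y) => h1.
  by rewrite ltr_pM2l ?subr_gt0 // /D; lra.
lra.
Qed.

Lemma quantized_channel (R : realType) (nu : {measure set (\bar R) -> \bar R})
    (w : \bar R -> R) (c r0 : R) :
  is_BMS nu w -> capacity nu w = c%:E -> r0 < c * ln 2 ->
  exists (T : finType) (s : T -> T) (e : T) (q : T -> R) (k : T -> \bar R -> R),
  [/\ involutive s, s e = e, (forall z, 0 < q z), \sum_z q z = 1
    & r0 < phi (lratio s q) q 0] /\
  [/\ (forall z y, 0 <= k z y), (forall y, \sum_z k z y = 1),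
      (forall z b, measurable_fun setT (fun y => k z y * chan_dens w (bpsk R b) y))
    & forall z b, (\int[nu]_y (k z y * chan_dens w (bpsk R b) y)%:E =
        (if b then q (s z) else q z)%:E)%E].
Proof.
move=> BMS capE r0c; have d0 : 0 < c * ln 2 - r0 by rewrite subr_gt0.
have ln2 : 0 < ln 2 :> R by apply: ln_gt0; rewrite ltr1n.
pose n := Num.truncn (c * ln 2 - r0)^-1.
have nd : 1 / n.+1%:R < c * ln 2 - r0.
  have i0 : 0 <= (c * ln 2 - r0)^-1 by rewrite invr_ge0 ltW.
  have /andP[_] := truncn_itv i0; rewrite -/n => h.
  by rewrite div1r -[ltRHS]invrK ltf_pV2 ?posrE ?invr_gt0 ?ltr0n.
have := capacity_le BMS n; rewrite capE lee_fin ler_pdivlMr // => hX.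
set X := \sum_c _ in hX.
have rX : r0 < X.
  by rewrite -(ltrD2r (1 / n.+1%:R)); apply: lt_le_trans hX; rewrite addrC -ltrBrDr.
pose Y := #|{: {ffun 'I_n -> bool} * {ffun 'I_n -> bool}}|%:R^-1 *
  \sum_(c : {ffun 'I_n -> bool} * {ffun 'I_n -> bool}) ln (1 + rho R c).
have [eps [e0 e1 hr]] := small_mixture Y rX.
exists ({ffun 'I_n -> bool} * {ffun 'I_n -> bool})%type, (@swap n).
(* The cell where both counts are 0 is fixed by [swap] and serves as the erasure. *)
exists ([ffun=> false], [ffun=> false]), (qlaw nu w eps), (ker w eps).
split; split.
- exact: swapK.
- by [].
- exact: qlaw_gt0.
- exact: sum_qlaw.
- have H := @phi_qlaw_ge R nu w BMS n eps e0 e1.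
  exact: (lt_le_trans hr H).
- exact: ker_ge0.
- exact: sum_ker.
- move=> z b; apply: measurable_funM; first exact: (measurable_ker BMS).
  exact: (measurable_chan BMS).
- exact: integral_ker.
Qed.

(** If [sep] vanished, all likelihood ratios would be 1 and [phi 0] would be 0. *)
Lemma sep_gt0 (R : realType) (T : finType) (s : T -> T) (q : T -> R) :
  (forall z, 0 < q z) -> 0 < phi (lratio s q) q 0 -> 0 < sep (lratio s q) q.
Proof.
move=> q0; set l := lratio s q => ph.
have l0 z : 0 < l z by rewrite divr_gt0.
have t0 z : 0 <= q z * ((1 - l z) ^+ 2 / (16 * (1 + l z))).
  by rewrite mulr_ge0 ?(ltW (q0 z)) // divr_ge0 ?sqr_ge0 // mulr_ge0 // addr_ge0 // ltW.
rewrite lt_neqAle sumr_ge0 // andbT; apply: contraTneq ph => /esym/eqP.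
rewrite psumr_eq0 // => /allP h; rewrite -leNgt /phi oppr_le0; apply: sumr_ge0 => z _.
have := h z (mem_index_enum z); rewrite /= mulf_eq0 gt_eqF //= mulf_eq0 invr_eq0.
rewrite [X in _ || X]gt_eqF ?mulr_gt0 ?addr_gt0 // orbF sqrf_eq0 subr_eq0 => /eqP lz.
by rewrite /lmix -lz subr0 addr0 mulr1 divff ?pnatr_eq0 // ln1 mulr0.
Qed.

Lemma bit_err_ge0 (R : realType) (nu : {measure set (\bar R) -> \bar R}) (w : \bar R -> R)
    (N : nat) (C : {set {ffun 'I_N -> bool}}) (i : 'I_N) :
  (forall y, 0 <= w y) -> (0 <= bit_err nu w C i)%E.
Proof.
move=> w0; apply: sume_ge0 => u _; apply: mule_ge0; first by rewrite lee_fin invr_ge0.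
by apply: iint_ge0 => y; rewrite lee_fin mulr_ge0 // lik_ge0.
Qed.

Local Open Scope classical_set_scope.

Theorem theorem1 (R : realType) (mu : {measure set (\bar R) -> \bar R})
  (w : \bar R -> R) :
  is_BMS mu w ->
  (0 < capacity mu w < 1)%E ->
  forall (r m : nat -> nat) (Rlim : R),
    (forall n, r n <= m n)%N ->
    (forall n, 2 ^ m n < 2 ^ m n.+1)%N ->
    (fun n => rate R (r n) (m n)) @ \oo --> Rlim ->
    0 <= Rlim -> (Rlim%:E < capacity mu w)%E ->
    (fun n => \big[Order.max/0%E]_(i < 2 ^ m n)
                 bit_err mu w (RM (r n) (m n)) i) @ \oo --> 0%E.
Proof.
move=> BMS /andP[cap0 cap1] r m Rlim rm mm cv R0 Rcap.
have ln2 : 0 < ln 2 :> R by apply: ln_gt0; rewrite ltr1n.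
have w0 y : 0 <= w y by case: BMS.
have capE : capacity mu w = (fine (capacity mu w))%:E.
  by rewrite fineK // ge0_fin_numE ?(ltW cap0) // (lt_trans cap1) // ltry.
rewrite capE lte_fin in Rcap.
have r0c : Rlim * ln 2 < fine (capacity mu w) * ln 2 by rewrite ltr_pM2r.
have [T [s [e [q [k [[sK se q0 q1 hphi] [k0 k1 mk Ik]]]]]]] := quantized_channel BMS capE r0c.
set l := lratio s q in hphi; set ph := phi l q 0 in hphi.
have l_gt0 z : 0 < l z by exact: lratio_gt0.
have l_s z : l (s z) = (l z)^-1 by exact: lratio_s.
have hq : symlaw s l q by exact: q_symlaw.
have r00 : 0 <= Rlim * ln 2 by rewrite mulr_ge0 // ltW.
have ph0 : 0 < ph by exact: le_lt_trans hphi.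
have sep0 : 0 < sep l q by exact: sep_gt0.
pose gap := ph - Rlim * ln 2; have gap0 : 0 < gap by rewrite subr_gt0.
(* Each of [theta] and [eta * ph] spends a quarter of the gap; a third quarter absorbs the deviation
   of the rates from their limit. *)
pose theta : R := gap / 4; pose eta : R := gap / (4 * ph).
have th0 : 0 < theta by rewrite divr_gt0.
have et0 : 0 < eta by rewrite divr_gt0 // mulr_gt0.
have et1 : eta < 1 by rewrite ltr_pdivrMr ?mulr_gt0 // mul1r /gap; lra.
have budget : Rlim * ln 2 + gap / 4 <= (1 - eta) * (ph - theta).
  have : eta * ph = gap / 4 by rewrite /eta; field; rewrite lt0r_neq0.
  have : 0 <= eta * theta by rewrite mulr_ge0 // ltW.
  by rewrite /theta /gap; lra.
(* The factor 2 of [RM_threshold] cancels against the division by 2 in [bit_err_mu]. *)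
pose B := ln 2 / (sep l q * (eta * theta)).
have st0 : 0 < sep l q * (eta * theta) by apply: mulr_gt0 => //; exact: mulr_gt0.
have B0 : 0 < B by rewrite divr_gt0.
pose v n : R := B * ('C(m n, r n)%:R / (2 ^ m n)%:R).
have v_ge0 n : 0 <= v n by rewrite mulr_ge0 ?(ltW B0) // divr_ge0.
(* Increasing blocklengths force [m n] to infinity, so the binomial ratio tends to 0 whatever [r n]
   is. *)
have mn n : (n <= m n)%N.
  elim: n => // n IH; apply: leq_ltn_trans IH _.
  by have := mm n; rewrite ltn_exp2l.
have v_cvg : v @ \oo --> (0 : R).
  apply/cvgrPdist_lt => d d0.
  have [M hM] := bin_ratio_small (divr_gt0 d0 B0).
  exists M => // n /= Mn; rewrite sub0r normrN ger0_norm //.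
  rewrite /v mulrC -ltr_pdivlMr //; apply: hM => //.
  exact: leq_trans (mn n).
have rate_lt : \forall n \near \oo, rate R (r n) (m n) < Rlim + gap / (4 * ln 2).
  by apply: (cvgr_lt _ cv); rewrite ltrDl divr_gt0 // mulr_gt0.
apply: (@squeeze_cvge _ _ _ _ (fun=> 0%E) _ (EFin \o v)).
- near=> n; apply/andP; split.
    apply: (big_ind (fun x => 0 <= x)%E) => // [x y x0 y0|i _].
      by rewrite le_max x0.
    exact: bit_err_ge0.
  apply: bigmax_le => [|i _]; first by rewrite lee_fin.
  have lin : linear_code (RM (r n) (m n)) by rewrite RM_RMlt; exact: RMlt_lin.
  apply: le_trans (bit_err_mu w0 sK se q0 q1 k0 k1 mk Ik i lin) _.
  rewrite lee_fin.
  have rt : rate R (r n) (m n) * ln 2 < (1 - eta) * (ph - theta).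
    apply: lt_le_trans budget.
    have : rate R (r n) (m n) < Rlim + gap / (4 * ln 2) by near: n.
    rewrite -(ltr_pM2r ln2) mulrDl => /lt_le_trans; apply; rewrite lerD2l.
    by rewrite le_eqVlt; apply/orP; left; apply/eqP; field; rewrite lt0r_neq0.
  have := RM_threshold sK l_gt0 l_s se hq i et0 et1 th0 rt.
  rewrite mulrC -ler_pdivlMr // => h.
  rewrite ler_pdivrMr //; apply: le_trans h _.
  rewrite le_eqVlt; apply/orP; left; apply/eqP; rewrite /v /B; field.
  by rewrite !lt0r_neq0 //= ltr0n expn_gt0.
- exact: cvg_cst.
- by apply/fine_cvgP; split; [exact: nearW | exact: v_cvg].
Unshelve. all: by end_near.
Qed.
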